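(* Let $\Gamma$ be a residually finite group, let $n\in\mathbb{Z}$, and let $X$ be a $\mathbb{Z}\Gamma$-chain complex. The following hold: (i) If $X\in\mathsf{CD}^\Gamma_n$, then $X\in\mathsf{H}^\Gamma_n(\mathbb{F})$ for every field $\mathbb{F}$; (ii) If $X\in\mathsf{CWR}^\Gamma_n$, then $X\in\mathsf{T}^\Gamma_{n-1}$; (iii) If $X\in\mathsf{CWR}^\Gamma_n$ and $X\in\mathsf{FG}^\Gamma_{n+1}(\mathbb{Z})$, then $X\in\mathsf{T}^\Gamma_n$; (iv) If the group $\Gamma$ lies in $\mathsf{CWR}_n$ and is of type $\mathsf{FP}_{n+1}$, then $\Gamma\in\mathsf{T}_n$.
   Context: A residual chain $\Lambda_*=(\Lambda_i)_{i\in\mathbb{N}}$ in a group $\Gamma$ is a nested sequence $\Gamma=\Lambda_0\ge\Lambda_1\ge\cdots$ of finite index normal subgroups of $\Gamma$ with $\bigcap_i\Lambda_i=\{1\}$; $\Gamma$ is residually finite if it admits a residual chain. $\Gamma$ is of type $\mathsf{FP}_n$ if the trivial $\mathbb{Z}\Gamma$-module $\mathbb{Z}$ has a projective resolution $P$ with $P_j$ finitely generated for all $j\le n$. A based free module is a free module with a chosen basis. A based free $\mathbb{Z}$-module carries the $\ell^1$-norm of its basis; $\|f\|$ denotes the operator norm of a map between based free $\mathbb{Z}$-modules. A chain complex ($\mathbb{Z}$-graded) is based free if all its chain modules are. A homotopy retract $(X,X',\xi,\xi',\Xi)$ consists of chain complexes $X,X'$, chain maps $\xi\colon X\to X'$,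 $\xi'\colon X'\to X$, and a chain homotopy $\Xi_j\colon X_j\to X_{j+1}$ with $\partial\Xi+\Xi\partial=\mathrm{id}_X-\xi'\xi$. Let $X,X'$ be based free $\mathbb{Z}$-chain complexes with $X_j,X'_j$ finitely generated for $j\le n$, and $T,\kappa\in\mathbb{R}_{\ge1}$. The homotopy retract is an $n$-domination of $X$ of quality $(T,\kappa)$ if $\mathrm{rk}_{\mathbb{Z}}(X'_j)\le\kappa T^{-1}\mathrm{rk}_{\mathbb{Z}}(X_j)$ for all $j\le n$. It is a weak $n$-rebuilding of quality $(T,\kappa)$ if moreover $\|\partial^{X'}_j\|,\|\xi_j\|\le\exp(\kappa)T^\kappa$ for all $j\le n$. For a $\mathbb{Z}\Gamma$-chain complex $X$ and $\Lambda\le\Gamma$, $X_\Lambda:=\mathbb{Z}\otimes_{\mathbb{Z}\Lambda}X$; if $X$ is based free over $\mathbb{Z}\Gamma$, then $X_\Lambda$ is based free over $\mathbb{Z}$ with the induced basis (the images of $\gamma e$, $\gamma\in\Gamma$, $e$ a basis element). $\mathsf{CWR}^\Gamma_n$ (resp. $\mathsf{CD}^\Gamma_n$) is the class of based free $\mathbb{Z}\Gamma$-chain complexes $X$ with $X_j$ finitely generated over $\mathbb{Z}\Gamma$ for all $j\le n$ such that: there exists $\kappa\ge1$ such that for all $T\ge1$ and all residual chains $\Lambda_*$ in $\Gamma$ there is $i_0\in\mathbb{N}$ such that for all $i\ge i_0$ the complex $X_{\Lambda_i}$ admits a weak $n$-rebuilding (resp. $n$-domination) of quality $(T,\kappa)$.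 $\mathsf{CWR}_n$ is the class of residually finite groups $\Gamma$ for which the trivial module $\mathbb{Z}$ admits a projective $\mathbb{Z}\Gamma$-resolution lying in $\mathsf{CWR}^\Gamma_n$. $\mathsf{FG}^\Gamma_n(\mathbb{Z})$ is the class of $\mathbb{Z}\Gamma$-chain complexes $X$ with $X_j$ finitely generated over $\mathbb{Z}\Gamma$ for all $j\le n$. $\mathsf{H}^\Gamma_n(\mathbb{F})$ is the class of $\mathbb{Z}\Gamma$-chain complexes $X$ with $\limsup_{i\to\infty}\frac{\dim_{\mathbb{F}}H_j(\mathbb{F}\otimes_{\mathbb{Z}}X_{\Lambda_i})}{[\Gamma:\Lambda_i]}=0$ for all residual chains $\Lambda_*$ in $\Gamma$ and all $j\le n$. $\mathsf{T}^\Gamma_n$ is the class of $\mathbb{Z}\Gamma$-chain complexes $X$ with $\limsup_{i\to\infty}\frac{\log\mathrm{tors}\,H_j(X_{\Lambda_i})}{[\Gamma:\Lambda_i]}=0$ for all residual chains $\Lambda_*$ in $\Gamma$ and all $j\le n$; $\mathrm{tors}$ is the cardinality of the torsion subgroup and $\log\infty=\infty$. $\mathsf{T}_n$ is the class of residually finite groups $\Gamma$ with $\limsup_{i\to\infty}\frac{\log\mathrm{tors}\,H_j(\Lambda_i;\mathbb{Z})}{[\Gamma:\Lambda_i]}=0$ for all residual chains $\Lambda_*$ in $\Gamma$ and all $j\le n$. *)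

(* Defs.v *)
From HB Require Import structures.
From mathcomp Require Import all_boot all_order all_algebra.
From mathcomp Require Import finmap.
From mathcomp.multinomials Require Import monalg.
From mathcomp Require Import all_classical all_reals all_analysis.

Set Implicit Arguments.
Unset Strict Implicit.
Unset Printing Implicit Defensive.

Import Order.TTheory GRing.Theory Num.Theory.

Local Open Scope classical_set_scope.
Local Open Scope quotient_scope.
Local Open Scope ring_scope.

Section FreeExt.
Context (R : nzRingType) (K : choiceType) (V : lmodType R) (h : K -> V).

Definition free_ext (m : {malg R[K]}) : V := \sum_(k <- msupp m) m@_k *: h k.

Lemma free_extw (d : {fset K}) m : (msupp m `<=` d)%fset ->
  free_ext m = \sum_(k <- d) m@_k *: h k.
Proof.
move=> le_d; apply: big_fset_incl => // k _ /mcoeff_outdom ->.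
by rewrite scale0r.
Qed.

Lemma free_ext_is_linear : linear free_ext.
Proof.
move=> a x y.
pose d := (msupp (a *: x + y) `|` (msupp x `|` msupp y))%fset.
rewrite (@free_extw d) ?fsubsetUl// (@free_extw d x); last first.
  by rewrite fsubsetU// fsubsetUl orbT.
rewrite (@free_extw d y); last by rewrite fsubsetU// fsubsetUr orbT.
rewrite scaler_sumr -big_split /=; apply: eq_bigr => k _.
by rewrite mcoeffD mcoeffZ scalerDl scalerA.
Qed.

HB.instance Definition _ :=
  GRing.isLinear.Build R {malg R[K]} V *:%R free_ext free_ext_is_linear.

Lemma free_extU c k : free_ext << c *g k >> = c *: h k.
Proof. by rewrite (free_extw msuppU_le) big_seq_fset1 mcoeffUU. Qed.

End FreeExt.

Section Quotient.
Context (R : nzRingType) (M : lmodType R).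

Definition is_submodule (N : set M) : Prop :=
  N 0 /\ forall a x y, N x -> N y -> N (a *: x + y).

Definition lspan (S : set M) : set M := smallest is_submodule S.

Lemma lspan_submodule S : is_submodule (lspan S).
Proof.
split=> [N [[N0 _] _] //|a x y Sx Sy N NS].
by apply: NS.1.2; [exact: Sx|exact: Sy].
Qed.

Context (S : set M).

Definition lspan_pred : {pred M} := fun x => `[< lspan S x >].

Lemma lspan_pred_zmod_closed : zmod_closed lspan_pred.
Proof.
have [S0 SD] := lspan_submodule S.
split=> [|x y /asboolP Sx /asboolP Sy]; apply/asboolP=> //.
by rewrite addrC -scaleN1r; exact: SD.
Qed.

HB.instance Definition _ :=
  GRing.isZmodClosed.Build M lspan_pred lspan_pred_zmod_closed.

Definition quotm : Type := Quotient.quot lspan_pred.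

HB.instance Definition _ := GRing.Zmodule.on quotm.

Definition quotm_pi (x : M) : quotm := \pi_(Quotient.quot lspan_pred) x.

Lemma quotm_piB : zmod_morphism quotm_pi.
Proof. exact: raddfB. Qed.

Lemma quotm_piP x y : quotm_pi x = quotm_pi y <-> lspan S (x - y).
Proof.
split=> [/eqP|xy]; first by rewrite -Quotient.idealrBE => /asboolP.
by apply/eqP; rewrite -Quotient.idealrBE; apply/asboolP.
Qed.

Lemma quotm_pi_surj (q : quotm) : exists x, quotm_pi x = q.
Proof. by exists (repr q); rewrite /quotm_pi reprK. Qed.

Definition quotm_scale (a : R) (q : quotm) : quotm := quotm_pi (a *: repr q).

Lemma quotm_scaleE a x : quotm_scale a (quotm_pi x) = quotm_pi (a *: x).
Proof.
apply/quotm_piP; rewrite -scalerBr -[_ *: _]addr0.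
have [S0 SD] := lspan_submodule S.
by apply: SD => //; apply/quotm_piP; rewrite /quotm_pi reprK.
Qed.

Lemma quotm_piD : {morph quotm_pi : x y / x + y}.
Proof. exact: raddfD. Qed.

Lemma quotm_scaleA a b q :
  quotm_scale a (quotm_scale b q) = quotm_scale (a * b) q.
Proof. by case: (quotm_pi_surj q) => x <-; rewrite !quotm_scaleE scalerA. Qed.

Lemma quotm_scale1 : left_id 1 quotm_scale.
Proof. by move=> q; case: (quotm_pi_surj q) => x <-; rewrite quotm_scaleE scale1r. Qed.

Lemma quotm_scaleDr : right_distributive quotm_scale +%R.
Proof.
move=> a p q; case: (quotm_pi_surj p) => x <-; case: (quotm_pi_surj q) => y <-.
by rewrite -quotm_piD !quotm_scaleE scalerDr quotm_piD.
Qed.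

Lemma quotm_scaleDl q : {morph quotm_scale^~ q : a b / a + b}.
Proof.
move=> a b; case: (quotm_pi_surj q) => x <-.
by rewrite !quotm_scaleE scalerDl quotm_piD.
Qed.

HB.instance Definition _ := GRing.Zmodule_isLmodule.Build R quotm
  quotm_scaleA quotm_scale1 quotm_scaleDr quotm_scaleDl.

Lemma quotm_pi_is_linear : linear quotm_pi.
Proof. by move=> a x y; rewrite quotm_piD -quotm_scaleE. Qed.

HB.instance Definition _ :=
  GRing.isLinear.Build R M quotm *:%R quotm_pi quotm_pi_is_linear.

Context (N : lmodType R) (f : {linear M -> N}).

Definition quotm_lift of (forall x, S x -> f x = 0) :=
  fun q : quotm => f (repr q) : N.

Hypothesis fS : forall x, S x -> f x = 0.

Lemma quotm_liftE x : quotm_lift fS (quotm_pi x) = f x.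
Proof.
apply/eqP; rewrite -subr_eq0 -linearB; apply/eqP.
suff /(_ (repr (quotm_pi x) - x)) : lspan S `<=` [set y | f y = 0].
  by apply; apply/quotm_piP; rewrite /quotm_pi reprK.
apply: smallest_sub => //; split=> [|a y z /= fy fz]; first exact: linear0.
by rewrite linearP fy fz scaler0 addr0.
Qed.

Lemma quotm_lift_is_linear : linear (quotm_lift fS).
Proof.
move=> a p q; case: (quotm_pi_surj p) => x <-; case: (quotm_pi_surj q) => y <-.
by rewrite -linearP !quotm_liftE linearP.
Qed.

HB.instance Definition _ :=
  GRing.isLinear.Build R quotm N *:%R (quotm_lift fS) quotm_lift_is_linear.

End Quotient.

Section Kernel.
Context (R : nzRingType) (M N : lmodType R) (f : {linear M -> N}).

Definition lker_pred : {pred M} := fun x => f x == 0.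

Lemma lker_pred_submod_closed : submod_closed lker_pred.
Proof.
split=> [|a x y /eqP fx /eqP fy]; first by apply/eqP; rewrite linear0.
by apply/eqP; rewrite linearP fx fy scaler0 addr0.
Qed.

HB.instance Definition _ :=
  GRing.isSubmodClosed.Build R M lker_pred lker_pred_submod_closed.

Record lker : predArgType := Lker { lker_val :> M; _ : lker_val \in lker_pred }.

HB.instance Definition _ := [isSub for lker_val].
HB.instance Definition _ := [Choice of lker by <:].
HB.instance Definition _ := [SubChoice_isSubLmodule of lker by <:].

End Kernel.

                                                                        
                                                            
                        
Record chain_complex (R : nzRingType) := ChainComplex {
  chain_mod :> int -> lmodType R;
  bd : forall i j, {linear chain_mod i -> chain_mod j};
  bd_shape : forall i j (x : chain_mod i), i != j + 1 -> bd i j x = 0;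
  bd_bd : forall i j k (x : chain_mod i), bd j k (bd i j x) = 0
}.

Definition homology (R : nzRingType) (X : chain_complex R) (j : int) :
    lmodType R :=
  quotm [set z : lker (bd X j (j - 1)) | exists y, bd X (j + 1) j y = val z].

                                                                          
                                                                    
                       
Section GroupRing.
Context (G : groupType).

Definition group_ring : Type := {malg int[G]}.

HB.instance Definition _ := GRing.Zmodule.on group_ring.

Implicit Types x y z : group_ring.

Definition grmul x y : group_ring :=
  \sum_(g <- msupp x) \sum_(h <- msupp y) << x@_g * y@_h *g (g * h)%g >>.

Lemma grmulw (d1 d2 : {fset G}) x y :
  (msupp x `<=` d1)%fset -> (msupp y `<=` d2)%fset ->
  grmul x y = \sum_(g <- d1) \sum_(h <- d2) << x@_g * y@_h *g (g * h)%g >>.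
Proof.
move=> le1 le2; rewrite /grmul (big_fset_incl _ le1) /=; last first.
  move=> g _ /mcoeff_outdom xg; rewrite big1 // => h _.
  by rewrite xg mul0r monalgU0.
apply: eq_bigr => g _; apply: big_fset_incl => // h _ /mcoeff_outdom ->.
by rewrite mulr0 monalgU0.
Qed.

Lemma grmulDl : left_distributive grmul +%R.
Proof.
move=> x y z; pose d := (msupp (x + y) `|` (msupp x `|` msupp y))%fset.
rewrite (@grmulw d (msupp z)) ?fsubsetUl// (@grmulw d (msupp z) x)//; last first.
  by rewrite fsubsetU// fsubsetUl orbT.
rewrite (@grmulw d (msupp z) y)//; last by rewrite fsubsetU// fsubsetUr orbT.
rewrite -big_split; apply: eq_bigr => g _.
rewrite -big_split; apply: eq_bigr => h _.
by rewrite mcoeffD mulrDl monalgUD.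
Qed.

Lemma grmulDr : right_distributive grmul +%R.
Proof.
move=> z x y; pose d := (msupp (x + y) `|` (msupp x `|` msupp y))%fset.
rewrite (@grmulw (msupp z) d) ?fsubsetUl// (@grmulw (msupp z) d _ x)//; last first.
  by rewrite fsubsetU// fsubsetUl orbT.
rewrite (@grmulw (msupp z) d _ y)//; last by rewrite fsubsetU// fsubsetUr orbT.
rewrite -big_split; apply: eq_bigr => g _.
rewrite -big_split; apply: eq_bigr => h _.
by rewrite mcoeffD mulrDr monalgUD.
Qed.

Lemma grmulUU a b g h :
  grmul << a *g g >> << b *g h >> = << a * b *g (g * h)%g >>.
Proof. by rewrite (grmulw msuppU_le msuppU_le) !big_seq_fset1 !mcoeffUU. Qed.

Lemma grmul0l : left_zero 0 grmul.
Proof. by move=> x; rewrite /grmul msupp0 big_seq_fset0. Qed.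

Lemma grmul0r : right_zero 0 grmul.
Proof.
by move=> x; rewrite /grmul big1 // => g _; rewrite msupp0 big_seq_fset0.
Qed.

Lemma gr_ind (P : group_ring -> Prop) :
  P 0 -> (forall x y, P x -> P y -> P (x + y)) ->
  (forall a g, P << a *g g >>) -> forall x, P x.
Proof.
by move=> P0 PD PU x; rewrite [x]monalgE; elim/big_ind: _ => // g _; exact: PU.
Qed.

#[local] Opaque grmul.

Lemma grmulA : associative grmul.
Proof.
move=> x y z.
elim/gr_ind: x => [|x x' IH IH'|a g].
- by rewrite !grmul0l.
- by rewrite (grmulDl x x' (grmul y z)) IH IH' (grmulDl x x' y) (grmulDl _ _ z).
elim/gr_ind: y => [|y y' IH IH'|b h].
- by rewrite grmul0l grmul0r grmul0l.
- by rewrite (grmulDl y y' z) (grmulDr _ _ (grmul y' z)) IH IH' (grmulDr _ y y') (grmulDl _ _ z).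
elim/gr_ind: z => [|z z' IH IH'|c k].
- by rewrite !grmul0r.
- by rewrite !grmulDr IH IH'.
by rewrite !grmulUU mulrA mulgA.
Qed.

Lemma grmul1l : left_id (<< 1%g >> : group_ring) grmul.
Proof.
elim/gr_ind => [|x y IH IH'|a g]; first exact: grmul0r.
  by rewrite grmulDr IH IH'.
by rewrite grmulUU mul1r mul1g.
Qed.

Lemma grmul1r : right_id (<< 1%g >> : group_ring) grmul.
Proof.
elim/gr_ind => [|x y IH IH'|a g]; first exact: grmul0l.
  by rewrite grmulDl IH IH'.
by rewrite grmulUU mulr1 mulg1.
Qed.

Lemma gr1_neq0 : (<< 1%g >> : group_ring) != 0.
Proof. by rewrite monalgU_eq0 oner_eq0. Qed.

HB.instance Definition _ := GRing.Zmodule_isNzRing.Build group_ring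
  grmulA grmul1l grmul1r grmulDl grmulDr gr1_neq0.

Definition gr_of (g : G) : group_ring := << g >>.

Section Lift.
Context (S : nzRingType) (h : G -> S).
Hypotheses (h1 : h 1%g = 1) (hM : forall a b, h (a * b)%g = h a * h b).

Definition gr_lift (x : group_ring) : S := \sum_(g <- msupp x) h g *~ x@_g.

Lemma gr_liftw (d : {fset G}) x : (msupp x `<=` d)%fset ->
  gr_lift x = \sum_(g <- d) h g *~ x@_g.
Proof.
by move=> le_d; apply: big_fset_incl => // g _ /mcoeff_outdom ->; rewrite mulr0z.
Qed.

Lemma gr_liftD : {morph gr_lift : x y / x + y}.
Proof.
move=> x y; pose d := (msupp (x + y) `|` (msupp x `|` msupp y))%fset.
rewrite (@gr_liftw d) ?fsubsetUl// (@gr_liftw d x); last first.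
  by rewrite fsubsetU// fsubsetUl orbT.
rewrite (@gr_liftw d y); last by rewrite fsubsetU// fsubsetUr orbT.
by rewrite -big_split; apply: eq_bigr => g _; rewrite mcoeffD mulrzDr.
Qed.

Lemma gr_lift0 : gr_lift 0 = 0.
Proof. by rewrite /gr_lift msupp0 big_seq_fset0. Qed.

Lemma gr_liftU a g : gr_lift << a *g g >> = h g *~ a.
Proof. by rewrite (gr_liftw msuppU_le) big_seq_fset1 mcoeffUU. Qed.

Lemma gr_lift_is_zmod_morphism : zmod_morphism gr_lift.
Proof.
move=> x y; apply: (addIr (gr_lift y)).
by rewrite -gr_liftD !addrNK.
Qed.

Lemma gr_lift_is_monoid_morphism : GRing.monoid_morphism gr_lift.
Proof.
split=> [|x y]; first by rewrite gr_liftU.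
elim/gr_ind: x => [|x x' IH IH'|a g].
- by rewrite mul0r gr_lift0 mul0r.
- by rewrite mulrDl !gr_liftD mulrDl IH IH'.
elim/gr_ind: y => [|y y' IH IH'|b k].
- by rewrite mulr0 gr_lift0 mulr0.
- by rewrite mulrDr !gr_liftD mulrDr IH IH'.
by rewrite [_ * _]grmulUU !gr_liftU hM mulrzAl mulrzAr -mulrzA mulrC.
Qed.
End Lift.

Definition augmentation : group_ring -> int := gr_lift (fun=> 1).

HB.instance Definition _ := GRing.isZmodMorphism.Build group_ring int
  augmentation (gr_lift_is_zmod_morphism _).
HB.instance Definition _ := GRing.isMonoidMorphism.Build group_ring int
  augmentation (gr_lift_is_monoid_morphism erefl (fun _ _ => esym (mulr1 1))).

End GroupRing.

Section GroupRingMap.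
Context (H G : groupType) (f : UMagmaMorphism.type H G).

Definition gr_map : group_ring H -> group_ring G :=
  gr_lift (fun h => gr_of (f h)).

Lemma gr_ofM (a b : G) : gr_of (a * b)%g = gr_of a * gr_of b.
Proof. by rewrite [RHS]grmulUU mulr1. Qed.

Lemma gr_map_is_monoid_morphism : GRing.monoid_morphism gr_map.
Proof.
apply: gr_lift_is_monoid_morphism; first by rewrite gmulf1.
by move=> a b; rewrite gmulfM gr_ofM.
Qed.

HB.instance Definition _ := GRing.isZmodMorphism.Build (group_ring H)
  (group_ring G) gr_map (gr_lift_is_zmod_morphism _).
HB.instance Definition _ := GRing.isMonoidMorphism.Build (group_ring H)
  (group_ring G) gr_map gr_map_is_monoid_morphism.

End GroupRingMap.

Definition restr (R S : nzRingType) (phi : {rmorphism R -> S})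
  (M : lmodType S) : Type := M.

Section Restriction.
Context (R S : nzRingType) (phi : {rmorphism R -> S}).

Section Module.
Context (M : lmodType S).
Local Notation restr := (restr phi M).

HB.instance Definition _ := GRing.Zmodule.on restr.

Definition restr_scale (a : R) (x : restr) : restr := phi a *: (x : M).

Lemma restr_scaleA a b x :
  restr_scale a (restr_scale b x) = restr_scale (a * b) x.
Proof. by rewrite /restr_scale scalerA rmorphM. Qed.

Lemma restr_scale1 : left_id 1 restr_scale.
Proof. by move=> x; rewrite /restr_scale rmorph1 scale1r. Qed.

Lemma restr_scaleDr : right_distributive restr_scale +%R.
Proof. by move=> a x y; exact: scalerDr. Qed.

Lemma restr_scaleDl x : {morph restr_scale^~ x : a b / a + b}.
Proof. by move=> a b; rewrite /restr_scale rmorphD scalerDl. Qed.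

HB.instance Definition _ := GRing.Zmodule_isLmodule.Build R restr
  restr_scaleA restr_scale1 restr_scaleDr restr_scaleDl.
End Module.

Section Map.
Context (M N : lmodType S) (f : {linear M -> N}).

Definition restr_map : restr phi M -> restr phi N := f.

Lemma restr_map_is_linear : linear restr_map.
Proof. by move=> a x y; exact: linearP. Qed.

HB.instance Definition _ := GRing.isLinear.Build R (restr phi M) (restr phi N) *:%R
  restr_map restr_map_is_linear.
End Map.

Definition restr_complex (X : chain_complex S) : chain_complex R :=
  @ChainComplex R (fun j => restr phi (X j))
    (fun i j => restr_map (bd X i j)) (@bd_shape S X) (@bd_bd S X).

End Restriction.

                                                                           
                                                                       
                                                              
                  
Section BaseChange.
Context (R S : nzRingType) (phi : {rmorphism R -> S}).

Section Module.
Context (M : lmodType R).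

Definition tensor_rel : set {malg S[M]} :=
  [set << x + y >> - (<< x >> + << y >>) | x in [set: M] & y in [set: M]] `|`
  [set << r *: x >> - phi r *: << x >> | r in [set: R] & x in [set: M]].

Definition base_change : lmodType S := quotm tensor_rel.

Definition tensor (s : S) (x : M) : base_change :=
  quotm_pi tensor_rel (s *: << x >>).
End Module.

Section Map.
Context (M N : lmodType R) (f : {linear M -> N}).

Definition base_change_gen : {linear {malg S[M]} -> base_change N} :=
  free_ext (fun x => tensor 1 (f x)).

Lemma base_change_gen0 z : tensor_rel z -> base_change_gen z = 0.
Proof.
have e1 x : base_change_gen << x >> = quotm_pi _ << f x >>.
  by rewrite [LHS]free_extU scale1r /tensor scale1r.
have eT (t : {malg S[N]}) : tensor_rel t -> quotm_pi (@tensor_rel N) t = 0.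
  move=> tt; rewrite -(linear0 (quotm_pi (@tensor_rel N))); apply/quotm_piP.
  by rewrite subr0; exact: sub_gen_smallest.
case=> [[x _ [y _ <-]]|[r _ [x _ <-]]].
- rewrite linearB linearD !e1 -linearD -linearB; apply: eT; left.
  by exists (f x) => //; exists (f y) => //; rewrite [f (x + y)]linearD.
- rewrite linearB linearZ !e1 -linearZ -linearB; apply: eT; right.
  by exists r => //; exists (f x) => //; rewrite [f (r *: x)]linearZ.
Qed.

Definition base_change_map : {linear base_change M -> base_change N} :=
  quotm_lift base_change_gen0.

Lemma base_change_mapE s x : base_change_map (tensor s x) = tensor s (f x).
Proof.
rewrite [LHS]quotm_liftE linearZ [base_change_gen _]free_extU scale1r.
by rewrite /tensor !linearZ /= scale1r.
Qed.
End Map.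

Lemma base_change_ind (M : lmodType R) (P : base_change M -> Prop) :
  P 0 -> (forall u v, P u -> P v -> P (u + v)) ->
  (forall s x, P (tensor s x)) -> forall u, P u.
Proof.
move=> P0 PD PT u; have [m <-] := quotm_pi_surj u.
rewrite [m]monalgE linear_sum; elim/big_ind: _ => // x _.
suff -> : << m@_x *g x >> = m@_x *: << x >> :> {malg S[M]} by exact: PT.
by apply/malgP => y; rewrite mcoeffZ !mcoeffU mulrnAr mulr1.
Qed.

Lemma tensor0 (M : lmodType R) s : tensor s (0 : M) = 0.
Proof.
rewrite /tensor linearZ /=.
suff -> : quotm_pi (@tensor_rel M) << 0 >> = 0 by rewrite scaler0.
rewrite -(linear0 (quotm_pi (@tensor_rel M))); apply/quotm_piP; rewrite subr0.
have -> : << 0 >> = << 0 *: 0 >> - phi 0 *: << 0 >> :> {malg S[M]}.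
  by rewrite rmorph0 !scale0r subr0.
by apply: sub_gen_smallest; right; exists 0 => //; exists 0.
Qed.

Section Complex.
Context (X : chain_complex R).

Lemma base_change_shape i j (u : base_change (X i)) :
  i != j + 1 -> base_change_map (bd X i j) u = 0.
Proof.
move=> ij; elim/base_change_ind: u => [|u v IHu IHv|s x].
- exact: linear0.
- by rewrite linearD IHu IHv addr0.
- by rewrite base_change_mapE bd_shape// tensor0.
Qed.

Lemma base_change_bd_bd i j k (u : base_change (X i)) :
  base_change_map (bd X j k) (base_change_map (bd X i j) u) = 0.
Proof.
elim/base_change_ind: u => [|u v IHu IHv|s x].
- by rewrite !linear0.
- by rewrite !linearD IHu IHv addr0.
- by rewrite !base_change_mapE bd_bd tensor0.
Qed.

Definition base_change_complex : chain_complex S :=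
  ChainComplex base_change_shape base_change_bd_bd.
End Complex.

End BaseChange.

Section Resolution.
Context (R : nzRingType).

Definition projective (P : lmodType R) : Prop :=
  forall (M N : lmodType R) (g : {linear M -> N}) (f : {linear P -> N}),
    (forall y, exists x, g x = y) ->
    exists h : {linear P -> M}, forall x, g (h x) = f x.

Definition projective_resolution (P : chain_complex R) (M : lmodType R) : Prop :=
  [/\ forall j, projective (P j),
      forall (j : int) (x : P j), j < 0 -> x = 0 &
      exists eps : {linear P 0 -> M},
        [/\ forall m, exists x, eps x = m,
            forall x, eps x = 0 <-> exists y, bd P 1 0 y = x &
            forall (j : int) (x : P j), 0 < j -> bd P j (j - 1) x = 0 ->
              exists y, bd P (j + 1) j y = x]].

Lemma free_ext_unique (K : choiceType) (V : lmodType R)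
    (f g : {linear {malg R[K]} -> V}) :
  (forall k, f << k >> = g << k >>) -> forall x, f x = g x.
Proof.
move=> fg x; rewrite [x]monalgE !linear_sum; apply: eq_bigr => k _.
suff -> : << x@_k *g k >> = x@_k *: << k >> :> {malg R[K]}.
  by rewrite !linearZ /= fg.
by apply/malgP => y; rewrite mcoeffZ !mcoeffU mulrnAr mulr1.
Qed.

Lemma free_projective (K : choiceType) : projective {malg R[K]}.
Proof.
move=> M N g f g_surj.
pose h (k : K) := projT1 (cid (g_surj (f << k >>))).
exists (free_ext h) => x.
apply: (@free_ext_unique _ _ (g \o free_ext h)) => k /=.
by rewrite free_extU scale1r /h; case: cid.
Qed.

Lemma zero_projective : projective 'rV[R]_0.
Proof.
move=> M N g f _; exists (\0 : {linear 'rV[R]_0 -> M}) => x /=.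
by rewrite linear0 [x]thinmx0 linear0.
Qed.

                                                                           
                                                       
Record res_step := ResStep {
  res_dom : lmodType R;
  res_cod : lmodType R;
  res_map : {linear res_dom -> res_cod}
}.

Definition res_next (s : res_step) : res_step :=
  @ResStep {malg R[lker (res_map s)]} (res_dom s)
    (free_ext (@lker_val _ _ _ (res_map s))).

Context (M : lmodType R).

Fixpoint res_seq (k : nat) : res_step :=
  if k is k'.+1 then res_next (res_seq k')
  else @ResStep {malg R[M]} M (free_ext id).

Definition res_mod (j : int) : lmodType R :=
  match j with Posz k => res_dom (res_seq k) | Negz _ => 'rV[R]_0 end.

Definition res_bd_nat (k l : nat) :
    {linear res_dom (res_seq k.+1) -> res_dom (res_seq l)} :=
  match @eqP _ k l with
  | ReflectT e =>
      ecast l {linear res_dom (res_seq k.+1) -> res_dom (res_seq l)} e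
        (res_map (res_seq k.+1))
  | ReflectF _ => \0
  end.

Definition res_bd (i j : int) : {linear res_mod i -> res_mod j} :=
  match i, j with
  | Posz k.+1, Posz l => res_bd_nat k l
  | _, _ => \0
  end.

Lemma res_bd_natE k (x : res_dom (res_seq k.+1)) :
  res_bd_nat k k x = res_map (res_seq k.+1) x.
Proof.
by rewrite /res_bd_nat; case: eqP => // e; rewrite (eq_irrelevance e erefl).
Qed.

Lemma res_bd_nat0 k l (x : res_dom (res_seq k.+1)) :
  k != l -> res_bd_nat k l x = 0.
Proof. by rewrite /res_bd_nat; case: eqP. Qed.

Lemma res_bd_shape i j (x : res_mod i) : i != j + 1 -> res_bd i j x = 0.
Proof.
case: i x => [[|k]|k] x //; case: j => [l|l] // kl.
by apply: res_bd_nat0; apply: contraNneq kl => ->; rewrite -addn1 PoszD.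
Qed.

Lemma res_map_map k (x : res_dom (res_seq k.+1)) :
  res_map (res_seq k) (res_map (res_seq k.+1) x) = 0.
Proof.
apply: (@free_ext_unique _ _
  (res_map (res_seq k) \o res_map (res_seq k.+1)) \0) => y /=.
by rewrite free_extU scale1r; apply/eqP; exact: (valP y).
Qed.

Lemma res_bd_nat_nat k l m (x : res_dom (res_seq k.+1)) :
  res_bd_nat l m (res_bd_nat k l.+1 x) = 0.
Proof.
have [e|/res_bd_nat0->] := eqVneq k l.+1; last exact: linear0.
have [<-|/res_bd_nat0->//] := eqVneq l m.
by subst k; rewrite !res_bd_natE res_map_map.
Qed.

Lemma res_bd_bd i j k (x : res_mod i) : res_bd j k (res_bd i j x) = 0.
Proof.
case: i x => [[|i]|i] x; try exact: linear0.
case: j => [[|j]|j] //; case: k => [k|k] //.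
exact: res_bd_nat_nat.
Qed.

Definition free_resolution : chain_complex R :=
  ChainComplex res_bd_shape res_bd_bd.

Lemma res_exact k (x : res_dom (res_seq k)) : res_map (res_seq k) x = 0 ->
  exists y, res_map (res_seq k.+1) y = x.
Proof.
move=> /eqP x0; exists << (@Lker _ _ _ (res_map (res_seq k)) x x0) >>.
by rewrite /= free_extU scale1r.
Qed.

Lemma free_resolutionP : projective_resolution free_resolution M.
Proof.
split=> [[[|k]|k]|[k|k] x //|].
- exact: free_projective.
- exact: free_projective.
- exact: zero_projective.
- by move=> _; rewrite [x]thinmx0.
exists (res_map (res_seq 0)); split=> [m|x|[[|k]|k] x // _].
- by exists << m >>; rewrite /= free_extU scale1r.
- split=> [x0|[y <-]].
    have [y <-] := @res_exact 0 x x0.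
    by exists y; rewrite [LHS]res_bd_natE.
  rewrite -[bd _ _ _ _]/(res_bd_nat 0 0 y) res_bd_natE; exact: (@res_map_map 0 y).
- have -> : Posz k.+1 - 1 = Posz k by rewrite -addn1 PoszD addrK.
  have -> : Posz k.+1 + 1 = Posz k.+2 by rewrite -PoszD addn1.
  rewrite -[bd _ _ _ _]/(res_bd_nat k k x) res_bd_natE => x0; have [y <-] := @res_exact k.+1 x x0.
  by exists y; rewrite [LHS]res_bd_natE.
Qed.

End Resolution.

Section Modules.
Context (R : nzRingType).

Definition fin_gen (M : lmodType R) : Prop :=
  exists s : seq M, lspan [set x | x \in s] = [set: M].

Definition is_coord (M : lmodType R) (B : set M) (x : M) (c : M -> R) : Prop :=
  [/\ finite_set [set b | c b != 0],
      [set b | c b != 0] `<=` B &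
      x = \sum_(b \in B) c b *: b].

Definition is_basis (M : lmodType R) (B : set M) : Prop :=
  forall x, exists! c : M -> R, is_coord B x c.

Definition basis_coord (M : lmodType R) (B : set M) (x : M) : M -> R :=
  xget (fun=> 0) [set c | is_coord B x c].

Definition fg_upto (n : int) (X : chain_complex R) : Prop :=
  forall j : int, j <= n -> fin_gen (X j).

Definition basis_family (X : chain_complex R) := forall j, set (X j).

Definition based_free (X : chain_complex R) (B : basis_family X) : Prop :=
  forall j, is_basis (B j).

                                                                          
Record homotopy_retract (X X' : chain_complex R) := HomotopyRetract {
  hr_to : forall j, {linear X j -> X' j};
  hr_from : forall j, {linear X' j -> X j};
  hr_htp : forall i j, {linear X i -> X j};
  hr_to_chain : forall i j x, bd X' i j (hr_to i x) = hr_to j (bd X i j x);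
  hr_from_chain : forall i j x,
    bd X i j (hr_from i x) = hr_from j (bd X' i j x);
  hr_htpP : forall j x,
    bd X (j + 1) j (hr_htp j (j + 1) x) + hr_htp (j - 1) j (bd X j (j - 1) x) =
    x - hr_from j (hr_to j x)
}.

End Modules.

Section Quality.
Context (R : realType).

                                                                           
            
Definition rank (A : nzRingType) (M : lmodType A) (B : set M) : nat :=
  #|` fset_set B|.

Definition l1norm (M : lmodType int) (B : set M) (x : M) : R :=
  (\sum_(b \in B) `|basis_coord B x b|)%:~R.

                                                                 
Definition opnorm (M N : lmodType int) (B : set M) (C : set N)
    (f : {linear M -> N}) : \bar R :=
  ereal_sup [set (l1norm C (f x) / l1norm B x)%:E | x in [set: M]].

Definition domination_quality (n : int) (T kappa : R)
    (X : chain_complex int) (B : basis_family X)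
    (X' : chain_complex int) (B' : basis_family X') : Prop :=
  [/\ based_free B', fg_upto n X' &
      forall j : int, j <= n -> (rank (B' j))%:R <= kappa * T^-1 * (rank (B j))%:R].

Definition admits_domination (n : int) (T kappa : R)
    (X : chain_complex int) (B : basis_family X) : Prop :=
  exists (X' : chain_complex int) (B' : basis_family X'),
    inhabited (homotopy_retract X X') /\ domination_quality n T kappa B B'.

Definition admits_weak_rebuilding (n : int) (T kappa : R)
    (X : chain_complex int) (B : basis_family X) : Prop :=
  exists (X' : chain_complex int) (B' : basis_family X')
      (h : homotopy_retract X X'),
    domination_quality n T kappa B B' /\
    forall j : int, j <= n ->
      (opnorm (B' j) (B' (j - 1)%R) (bd X' j (j - 1)%R) <=
         (expR kappa * T `^ kappa)%R%:E)%E /\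
      (opnorm (B j) (B' j) (hr_to h j) <= (expR kappa * T `^ kappa)%R%:E)%E.

                                                                     
                                                     
Definition dimension (F : fieldType) (V : lmodType F) : \bar R :=
  ereal_sup [set k%:R%:E | k in [set k : nat | exists v : 'I_k -> V,
    forall c : 'I_k -> F, \sum_i c i *: v i = 0 -> forall i, c i = 0]].

Definition tors_card (M : lmodType int) : \bar R :=
  counting [set x : M | exists2 k : nat, (0 < k)%N & x *+ k = 0].

End Quality.

Section Subgroup.
Context (G : groupType) (L : groupClosed G).

Record subgrp : predArgType :=
  Subgrp { subgrp_val :> G; _ : subgrp_val \in (L : {pred G}) }.

HB.instance Definition _ := [isSub for subgrp_val].
HB.instance Definition _ := [Choice of subgrp by <:].

Lemma subgrp_closed : group_closed (L : {pred G}).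
Proof. by split; [exact: gpred1|exact: gpredF]. Qed.

HB.instance Definition _ := SubChoice_isSubGroup.Build G _ subgrp subgrp_closed.

Definition cosets : set (set G) :=
  [set [set (x * y)%g | y in [set y | y \in (L : {pred G})]] | x in [set: G]].

Definition subgroup_index : nat := #|` fset_set cosets|.

Lemma subgrp_valM : {morph subgrp_val : x y / (x * y)%g}.
Proof. by []. Qed.

Lemma subgrp_val1 : subgrp_val 1%g = 1%g.
Proof. by []. Qed.

HB.instance Definition _ :=
  monoid.isMultiplicative.Build subgrp G subgrp_val subgrp_valM.
HB.instance Definition _ :=
  Multiplicative_isUMagmaMorphism.Build subgrp G subgrp_val subgrp_val1.

End Subgroup.

Definition residual_chain (G : groupType) (L : nat -> groupClosed G) : Prop :=
  [/\ forall x, x \in (L 0%N : {pred G}),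
      forall i, {subset (L i.+1 : {pred G}) <= (L i : {pred G})},
      forall i x y, x \in (L i : {pred G}) -> (x ^ y)%g \in (L i : {pred G}),
      forall i, finite_set (cosets (L i)) &
      forall x, (forall i, x \in (L i : {pred G})) -> x = 1%g].

Definition residually_finite (G : groupType) : Prop :=
  exists L : nat -> groupClosed G, residual_chain L.

Section Coinvariants.
Context (G : groupType) (L : groupClosed G).

                                                         
Definition coinv (X : chain_complex (group_ring G)) : chain_complex int :=
  base_change_complex (@augmentation (subgrp L))
    (restr_complex (gr_map (@subgrp_val G L)) X).

                                                                           
Definition coinv_basis (X : chain_complex (group_ring G))
    (B : basis_family X) : basis_family (coinv X) := fun j =>
  [set tensor (@augmentation (subgrp L)) 1
         (gr_of g *: e : restr (gr_map (@subgrp_val G L)) (X j))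
     | g in [set: G] & e in B j].

End Coinvariants.

Arguments coinv_basis {G} L {X} B.

Definition trivial_module (G : groupType) : lmodType (group_ring G) :=
  restr (@augmentation G) int^o.

Definition type_FP (G : groupType) (n : int) : Prop :=
  exists P : chain_complex (group_ring G),
    projective_resolution P (trivial_module G) /\ fg_upto n P.

Definition group_homology (G : groupType) (j : int) : lmodType int :=
  homology (base_change_complex (@augmentation G)
    (free_resolution (trivial_module G))) j.

Section Classes.
Context (R : realType) (G : groupType) (n : int).
Implicit Types X : chain_complex (group_ring G).

                                                                      
                                                              
Definition cheap
    (Q : R -> R -> forall Y : chain_complex int, basis_family Y -> Prop) X :
    Prop :=
  exists B : basis_family X,
  [/\ based_free B, fg_upto n X &
      exists2 kappa : R, 1 <= kappa & forall T : R, 1 <= T ->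
        forall L : nat -> groupClosed G, residual_chain L ->
        exists i0 : nat, forall i, (i0 <= i)%N ->
          Q T kappa _ (coinv_basis (L i) B)].

Definition CD X : Prop := cheap (@admits_domination R n) X.

Definition CWR X : Prop := cheap (@admits_weak_rebuilding R n) X.

Definition CWR_group : Prop :=
  residually_finite G /\
  exists P, projective_resolution P (trivial_module G) /\ CWR P.

Local Open Scope ereal_scope.

Definition Hvanish (F : fieldType) X : Prop :=
  forall L : nat -> groupClosed G, residual_chain L -> forall j : int, (j <= n)%R ->
    limn_esup (fun i =>
      dimension R (homology (base_change_complex (intr : {rmorphism int -> F})
                               (coinv (L i) X)) j)
      / (subgroup_index (L i))%:R%:E) = 0.

Definition Tvanish X : Prop :=
  forall L : nat -> groupClosed G, residual_chain L -> forall j : int, (j <= n)%R ->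
    limn_esup (fun i =>
      lne (tors_card R (homology (coinv (L i) X) j))
      / (subgroup_index (L i))%:R%:E) = 0.

Definition Tvanish_group : Prop :=
  residually_finite G /\
  forall L : nat -> groupClosed G, residual_chain L -> forall j : int, (j <= n)%R ->
    limn_esup (fun i =>
      lne (tors_card R (group_homology (subgrp (L i)) j))
      / (subgroup_index (L i))%:R%:E) = 0.

End Classes.

(* Main.v *)
From HB Require Import structures.
Require Import Defs.
From mathcomp Require Import all_boot all_order all_algebra perm finmap.
From mathcomp.multinomials Require Import monalg.
From mathcomp Require Import all_classical all_reals all_analysis.
From mathcomp Require Import ring lra.

(** If [X'] is a retract of the coinvariants [X_L] up to homotopy, then [H_j(X_L)]
    embeds in [H_j(X')].  Over a field the latter has dimension at most [rk X'_j], and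
    [rk X'_j <= kappa / T * rk X_j * [G : L]]; let [T] grow.

    For the torsion, [hr_to] embeds [H_j(X_L)] in the quotient of [X'_j] by the image
    of [hr_to \o bd], because a cycle [z] with [hr_to z = hr_to (bd y)] is the
    boundary of [hr_htp (z - bd y) + y].  If the boundaries of degree [j] in [X] are
    finitely generated over the group ring, that image is generated by vectors whose
    l1-norm is at most [D = K e^kappa T^kappa] with [K] independent of [L] and [T].
    The torsion of a quotient of [Z^r] by vectors of norm at most [D >= 1] has at most
    [D^r] elements (a nonzero minor of maximal size bounds it), so its logarithm is at
    most [rk X'_j * ln D], which is [O(ln T / T)] relative to [G : L].
    For a resolution of a group of type FP_(n+1), finite generation of the boundaries
    in degrees up to [n] follows by comparison with a resolution that is finitely
    generated up to degree [n + 1]. *)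

Set Implicit Arguments.
Unset Strict Implicit.
Unset Printing Implicit Defensive.

Import Order.TTheory GRing.Theory Num.Theory.

Local Open Scope classical_set_scope.
Local Open Scope ring_scope.

(** * Spans and bases *)

Section Span.
Context (R : nzRingType).
Implicit Types M N : lmodType R.

Lemma lspan_min M (A S : set M) : is_submodule A -> S `<=` A -> lspan S `<=` A.
Proof. by move=> Asub SA; apply: smallest_sub. Qed.

Lemma lspan_gen M (S : set M) : S `<=` lspan S.
Proof. by move=> x Sx; apply: sub_gen_smallest. Qed.

Lemma lspan0 M (S : set M) : lspan S 0.
Proof. exact: (lspan_submodule S).1. Qed.

Lemma lspanP M (S : set M) a x y :
  lspan S x -> lspan S y -> lspan S (a *: x + y).
Proof. exact: (lspan_submodule S).2. Qed.

Lemma lspanD M (S : set M) x y : lspan S x -> lspan S y -> lspan S (x + y).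
Proof. by move=> Sx Sy; rewrite -[x]scale1r; apply: lspanP. Qed.

Lemma lspanZ M (S : set M) a x : lspan S x -> lspan S (a *: x).
Proof. by move=> Sx; rewrite -[_ *: _]addr0; apply: lspanP => //; apply: lspan0. Qed.

Lemma lspanB M (S : set M) x y : lspan S x -> lspan S y -> lspan S (x - y).
Proof. by move=> Sx Sy; rewrite addrC -scaleN1r; apply: lspanP. Qed.

Lemma lspan_sum M (S : set M) I (r : seq I) (P : pred I) (F : I -> M) :
  (forall i, P i -> lspan S (F i)) -> lspan S (\sum_(i <- r | P i) F i).
Proof.
move=> SF; elim/big_ind: _ => //; first exact: lspan0.
by move=> x y; exact: lspanD.
Qed.

Lemma preimage_submodule M N (f : {linear M -> N}) (A : set N) :
  is_submodule A -> is_submodule (f @^-1` A).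
Proof.
move=> [A0 AD]; split=> [|a x y Ax Ay]; first by rewrite /preimage /= linear0.
by rewrite /preimage /= linearP; exact: AD.
Qed.

Lemma image_submodule M N (f : {linear M -> N}) (A : set M) :
  is_submodule A -> is_submodule (f @` A).
Proof.
move=> [A0 AD]; split=> [|a _ _ [x Ax <-] [y Ay <-]].
  by exists 0; rewrite ?linear0.
by exists (a *: x + y); rewrite ?linearP //; apply: AD.
Qed.

Lemma lspan_map M N (f : {linear M -> N}) (S : set M) (A : set N) x :
  is_submodule A -> (forall s, S s -> A (f s)) -> lspan S x -> A (f x).
Proof.
move=> Asub SA; apply: (lspan_min (A := f @^-1` A)) => //.
exact: preimage_submodule.
Qed.

Lemma lspan_image M N (f : {linear M -> N}) (S : set M) :
  lspan (f @` S) `<=` f @` lspan S.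
Proof.
apply: lspan_min; first exact/image_submodule/lspan_submodule.
by move=> _ [x Sx <-]; exists x => //; apply: lspan_gen.
Qed.

Lemma linear_eq_lspan M N (f g : {linear M -> N}) (S : set M) x :
  (forall s, S s -> f s = g s) -> lspan S x -> f x = g x.
Proof.
move=> fg; apply: (lspan_min (A := [set x | f x = g x])) => //.
split=> [|a y z /= fy fz]; first by rewrite /= !linear0.
by rewrite !linearP fy fz.
Qed.

End Span.

Section Basis.
Context (R : nzRingType).
Implicit Types M N : lmodType R.

Lemma fsum_fset (T : choiceType) (V : nmodType) (B : set T) (U : {fset T})
    (F : T -> V) : [set` U] `<=` B -> (forall b, b \notin U -> F b = 0) ->
  \sum_(b \in B) F b = \sum_(b <- U) F b.
Proof.
move=> UB F0; rewrite (fsbigE U) //; last by move=> b _; exact: F0.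
rewrite big_seq_cond [RHS]big_seq; apply: eq_bigl => b.
by case: (boolP (b \in U)) => //= /UB Bb; rewrite mem_set.
Qed.

Lemma is_coord_fset M (B : set M) x c : is_coord B x c <->
  exists U : {fset M}, [/\ [set` U] `<=` B, forall b, b \notin U -> c b = 0 &
    x = \sum_(b <- U) c b *: b].
Proof.
split=> [[fc cB ->]|[U [UB cU ->]]].
  have c0 b : b \notin fset_set [set b | c b != 0] -> c b = 0.
    by rewrite in_fset_set // notin_setE /= => /negP; rewrite negbK => /eqP.
  have UB : [set` fset_set [set b | c b != 0]] `<=` B.
    by move=> b /=; rewrite in_fset_set // inE => /cB.
  exists (fset_set [set b | c b != 0]); split=> //.
  by apply: fsum_fset => // b /c0 ->; rewrite scale0r.
have suppU : [set b | c b != 0] `<=` [set` U].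
  by move=> b /=; apply: contra_neqT => /cU.
split; [exact: sub_finite_set suppU _|by move=> b /suppU /UB|].
by rewrite (@fsum_fset _ _ B U) // => b /cU ->; rewrite scale0r.
Qed.

Lemma is_coordP M (B : set M) a x y c d : is_coord B x c -> is_coord B y d ->
  is_coord B (a *: x + y) (fun b => a * c b + d b).
Proof.
move=> /is_coord_fset[U [UB cU ->]] /is_coord_fset[V [VB dV ->]].
apply/is_coord_fset; exists (U `|` V)%fset.
have widen (W : {fset M}) (e : M -> R) : (W `<=` U `|` V)%fset ->
    (forall b, b \notin W -> e b = 0) ->
    \sum_(b <- W) e b *: b = \sum_(b <- (U `|` V)%fset) e b *: b.
  by move=> WU eW; apply: big_fset_incl => // b _ /eW ->; rewrite scale0r.
split=> [b|b|].
- by rewrite /= inE => /orP[/UB|/VB].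
- by rewrite inE negb_or => /andP[/cU -> /dV ->]; rewrite mulr0 addr0.
rewrite (widen U) ?fsubsetUl // (widen V) ?fsubsetUr // scaler_sumr -big_split.
by apply: eq_bigr => b _; rewrite scalerDl scalerA.
Qed.

Lemma is_coord_gen M (B : set M) b : B b ->
  is_coord B b (fun b' => (b' == b)%:R).
Proof.
move=> Bb; apply/is_coord_fset; exists [fset b]%fset; split=> [b'|b'|].
- by rewrite /= inE => /eqP ->.
- by rewrite inE => /negbTE ->.
- by rewrite big_seq_fset1 eqxx scale1r.
Qed.

Lemma is_coord0 M (B : set M) : is_coord B 0 (fun=> 0).
Proof.
apply/is_coord_fset; exists fset0; split=> //.
by rewrite big_seq_fset0.
Qed.

Lemma lspan_coord M (B : set M) x : lspan B x <-> exists c, is_coord B x c.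
Proof.
split=> [|[c /is_coord_fset[U [UB _ ->]]]]; last first.
  by rewrite big_seq; apply: lspan_sum => b /UB Bb; apply: lspanZ; apply: lspan_gen.
apply: (lspan_min (A := [set x | exists c, is_coord B x c])) => [|b Bb].
  split=> [|a y z [c yc] [d zd]]; first by exists (fun=> 0); exact: is_coord0.
  by exists (fun b => a * c b + d b); exact: is_coordP.
by exists (fun b' => (b' == b)%:R); exact: is_coord_gen.
Qed.

(** The functional dual to [b] reads off the coefficient at [b], so coordinates are unique. Bases of
    base changes and of restricted modules are recognised this way. *)
Lemma is_basis_dual M (B : set M) :
  (forall x, lspan B x) ->
  (forall b, B b -> exists f : {linear M -> R^o},
     forall b', B b' -> f b' = (b == b')%:R) ->
  is_basis B.
Proof.
move=> Bspan Bdual x; have [c xc] := (lspan_coord B x).1 (Bspan x).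
exists c; split=> // d xd.
suff coordE e b (f : {linear M -> R^o}) : B b ->
    (forall b', B b' -> f b' = (b == b')%:R) -> is_coord B x e -> e b = f x.
  apply/funext => b; have [Bb|nBb] := pselect (B b).
    by have [f fB] := Bdual b Bb; rewrite !(coordE _ _ _ Bb fB).
  have out e : is_coord B x e -> e b = 0.
    by move=> [_ eB _]; apply/eqP/negPn/negP => /eB.
  by rewrite !out.
move=> Bb fB /is_coord_fset[U [UB eU ->]].
rewrite linear_sum (eq_big_seq (fun b' => e b' * (b == b')%:R)); last first.
  by move=> b' /UB Bb'; rewrite linearZ /= fB.
have [bU|bU] := boolP (b \in U); last first.
  rewrite eU // big_seq big1 // => b' b'U.
  by case: eqP b'U bU => [->->//|]; rewrite mulr0.
rewrite (big_fsetD1 b) //= eqxx mulr1 big_seq big1 ?addr0 // => b'.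
by rewrite !inE eq_sym => /andP[/negbTE -> _]; rewrite mulr0.
Qed.

Section Coordinates.
Context (M : lmodType R) (B : set M) (Bb : is_basis B).

Lemma basis_coordP x : is_coord B x (basis_coord B x).
Proof.
rewrite /basis_coord; have [c [xc _]] := Bb x.
by case: xgetP => [d ->//|/(_ c)].
Qed.

Lemma basis_coord_unique x c : is_coord B x c -> basis_coord B x = c.
Proof.
move=> xc; have [d [_ du]] := Bb x.
by rewrite -(du _ xc) -(du _ (basis_coordP x)).
Qed.

Lemma basis_coord_linear b : linear (basis_coord B ^~ b : M -> R^o).
Proof.
move=> a x y /=; rewrite (@basis_coord_unique (a *: x + y)
  (fun b => a * basis_coord B x b + basis_coord B y b)) //.
by apply: is_coordP; exact: basis_coordP.
Qed.

Lemma basis_coordD x y b :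
  basis_coord B (x + y) b = basis_coord B x b + basis_coord B y b.
Proof. by rewrite -[x in LHS]scale1r basis_coord_linear // scale1r. Qed.

Lemma basis_coordZ a x b : basis_coord B (a *: x) b = a * basis_coord B x b.
Proof.
rewrite -[a *: x]addr0 basis_coord_linear // (basis_coord_unique (is_coord0 B)).
by rewrite addr0.
Qed.

Lemma basis_coord_gen b b' : B b -> basis_coord B b b' = (b' == b)%:R.
Proof. by move=> /is_coord_gen/basis_coord_unique ->. Qed.

Lemma basis_lspan x : lspan B x.
Proof. by apply/lspan_coord; exists (basis_coord B x); exact: basis_coordP. Qed.

Lemma basis_coord_sum (U : {fset M}) x :
  (forall b, b \notin U -> basis_coord B x b = 0) ->
  [set` U] `<=` B -> x = \sum_(b <- U) basis_coord B x b *: b.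
Proof.
move=> xU UB; rewrite -(@fsum_fset _ _ B) //; first by case: (basis_coordP x).
by move=> b /xU ->; rewrite scale0r.
Qed.

Lemma basis_linear_ext (N : lmodType R) (h : M -> N) :
  exists f : {linear M -> N}, forall b, B b -> f b = h b.
Proof.
have supp x : exists U : {fset M}, [set` U] `<=` B /\
    forall b, b \notin U -> basis_coord B x b = 0.
  by have /is_coord_fset[U [? ? _]] := basis_coordP x; exists U.
pose F x := \sum_(b \in B) basis_coord B x b *: h b.
have FE (U : {fset M}) x : [set` U] `<=` B ->
    (forall b, b \notin U -> basis_coord B x b = 0) ->
    F x = \sum_(b <- U) basis_coord B x b *: h b.
  by move=> UB xU; apply: fsum_fset => // b /xU ->; rewrite scale0r.
have Flin : linear F.
  move=> a x y; have [U [UB xU]] := supp x; have [V [VB yV]] := supp y.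
  have UVB : [set` (U `|` V)%fset] `<=` B.
    by move=> b; rewrite /= inE => /orP[/UB|/VB].
  have xW b : b \notin (U `|` V)%fset -> basis_coord B x b = 0.
    by rewrite inE negb_or => /andP[/xU].
  have yW b : b \notin (U `|` V)%fset -> basis_coord B y b = 0.
    by rewrite inE negb_or => /andP[_ /yV].
  rewrite !(FE (U `|` V)%fset) //; last first.
    by move=> b bU; rewrite basis_coord_linear xW // yW // scaler0 addr0.
  rewrite scaler_sumr -big_split; apply: eq_bigr => b _.
  by rewrite basis_coord_linear scalerDl scalerA.
pose Fl := GRing.isLinear.Build R M N *:%R F Flin.
exists (HB.pack F Fl : {linear M -> N}) => b Bb' /=.
rewrite (FE [fset b]%fset) => [|b'|b']; rewrite ?big_seq_fset1.
- by rewrite basis_coord_gen // eqxx scale1r.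
- by rewrite /= inE => /eqP ->.
- by rewrite inE basis_coord_gen // => /negbTE ->.
Qed.

Lemma basis_projective : projective M.
Proof.
move=> N N' g f g_surj.
have [h hB] := basis_linear_ext (fun b => projT1 (cid (g_surj (f b)))).
exists h => x.
apply: (@linear_eq_lspan _ _ _ (g \o h) f B _ _ (basis_lspan x)) => b Bb' /=.
by rewrite hB //; case: cid.
Qed.

(** The supports of the finitely many generators lie in a finite [U]. Every [b] in [B] is then a
    combination of [U], and uniqueness of coordinates puts [b] in [U]. *)
Lemma basis_finite : fin_gen M -> finite_set B.
Proof.
move=> [s sM].
have [U [UB sU]] : exists U : {fset M}, [set` U] `<=` B /\
    forall x, x \in s -> lspan [set` U] x.
  elim: s {sM} => [|x s [U [UB sU]]]; first by exists fset0; split.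
  have /is_coord_fset[V [VB xV xE]] := basis_coordP x.
  exists (U `|` V)%fset; split=> [b|y]; first by rewrite /= inE => /orP[/UB|/VB].
  have sub (W : {fset M}) : (W `<=` U `|` V)%fset ->
      lspan [set` W] `<=` lspan [set` (U `|` V)%fset].
    move=> /fsubsetP WU; apply: lspan_min; first exact: lspan_submodule.
    by move=> b /= /WU bU; apply: lspan_gen.
  rewrite inE => /orP[/eqP ->|/sU]; last by apply: sub; exact: fsubsetUl.
  apply: (sub V); rewrite ?fsubsetUr // xE big_seq.
  by apply: lspan_sum => b bV; apply: lspanZ; apply: lspan_gen.
apply: (@sub_finite_set _ _ [set` U]) => // b Bb0.
have : lspan [set` U] b.
  suff: [set: M] b by rewrite -sM; apply: lspan_min => //; exact: lspan_submodule.
  by [].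
move=> /lspan_coord[c /is_coord_fset[V [VU cV bE]]].
have bc : is_coord B b c by apply/is_coord_fset; exists V; split=> // b' /VU/UB.
have cb : c b = 1.
  by rewrite -(basis_coord_unique bc) basis_coord_gen // eqxx.
by apply: VU => /=; apply: contraT => /cV; rewrite cb => /eqP; rewrite oner_eq0.
Qed.

End Coordinates.
End Basis.

(** * Torsion of quotients of integer lattices *)

Lemma normz_det_unit k (A : 'M[int]_k) : A \in unitmx -> `|\det A|%N = 1%N.
Proof. by rewrite unitmxE => /orP[]/eqP->. Qed.

(** The Smith normal form writes [M] as a diagonal matrix between the unimodular [L] and [P]. The
    map [f] records [x *m invmx P] modulo the diagonal entries, whose absolute values multiply to
    that of [\det M]. *)
Lemma int_coker_count k (M : 'M[int]_k) : \det M != 0 ->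
  exists (T : finType) (f : 'rV[int]_k -> T),
    #|T| = `|\det M|%N /\
    forall x y, f x = f y -> exists u, x - y = u *m M.
Proof.
move=> detM; have [L L1 [P P1 [d _ ME]]] := int_Smith_normal_form M.
have dE : (\matrix_(i, j) (d`_i *+ (i == j :> nat)))%R = diag_mx (\row_(i < k) d`_i).
  by apply/matrixP => i j; rewrite !mxE.
rewrite dE in ME => {dE}; pose e (i : 'I_k) : int := d`_i.
have detME : `|\det M|%N = (\prod_(i < k) `|e i|)%N.
  rewrite ME !det_mulmx !abszM (normz_det_unit L1) (normz_det_unit P1).
  rewrite mul1n muln1 det_diag.
  rewrite (big_morph absz abszM absz1); apply: eq_bigr => i _; by rewrite mxE.
have d_gt0 (i : 'I_k) : (0 < `|e i|)%N.
  rewrite absz_gt0; apply: contraNneq detM => di.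
  by rewrite -absz_eq0 detME (bigD1 i) //= di mul0n.
pose T : finType := {dffun forall i : 'I_k, 'I_(`|e i|.-1.+1)}.
have modP (i : 'I_k) (z : int) : (`|(z %% e i)%Z| < `|e i|.-1.+1)%N.
  rewrite prednK // -ltz_nat gez0_abs ?modz_ge0 -?absz_gt0 //.
  by rewrite abszE; apply: ltz_mod; rewrite -absz_gt0.
pose g (x : 'rV[int]_k) (i : 'I_k) : int := (x *m invmx P) 0 i.
pose f (x : 'rV[int]_k) : T := [ffun i => Ordinal (modP i (g x i))].
exists T, f; split.
  rewrite card_dep_ffun detME foldrE big_map big_enum /=.
  by apply: eq_bigr => i _; rewrite card_ord prednK.
move=> x y /ffunP fxy.
have dvd (i : 'I_k) : (e i %| g x i - g y i)%Z.
  have := congr1 val (fxy i); rewrite !ffunE /= => exy.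
  rewrite -eqz_mod_dvd; apply/eqP.
  have nn z : (0 <= z %% e i)%Z by rewrite modz_ge0 // -absz_gt0.
  by rewrite -[LHS]gez0_abs // -[RHS]gez0_abs // exy.
pose w := \row_(i < k) ((g x i - g y i) %/ e i)%Z.
exists (w *m invmx L); rewrite ME !mulmxA mulmxKV //.
have -> : w *m diag_mx (\row_i d`_i) = (x - y) *m invmx P.
  rewrite mulmxBl; apply/rowP => i.
  by rewrite mul_mx_diag [LHS]mxE [X in X * _]mxE [X in _ * X]mxE divzK //
    [RHS]mxE [X in _ = _ + X]mxE.
by rewrite mulmxKV.
Qed.

(** The product of the row sums expands into one nonnegative term for each self-map of ['I_k]; the
    terms of the permutations already dominate the Leibniz formula. *)
Lemma det_le_prod_norm (F : numDomainType) k (A : 'M[F]_k) :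
  `|\det A| <= \prod_i \sum_j `|A i j|.
Proof.
rewrite /determinant bigA_distr_bigA /=.
apply: le_trans (ler_norm_sum _ _ _) _.
rewrite (eq_bigr (fun s : 'S_k => \prod_i `|A i (pval s i)|)); last first.
  move=> s _; rewrite normrM normrX normrN1 expr1n mul1r normr_prod.
  by apply: eq_bigr => i _; rewrite pvalE.
rewrite -(big_imset (fun f : {ffun 'I_k -> 'I_k} => \prod_i `|A i (f i)|)) /=.
  rewrite [leRHS](bigID [in [set pval s | s : 'S_k]%SET]) /=.
  by rewrite lerDl sumr_ge0 // => f _; apply: prodr_ge0.
by move=> s t _ _; exact: val_inj.
Qed.

(** An independent family has at most [r] rows, so a longest one exists; any [s] outside its
    rational span would extend it. Choosing the rows inside [S] itself preserves every norm bound
    known on [S]. *)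
Lemma maximal_free_rows r (S : set 'rV[int]_r) :
  exists k (V : 'M[int]_(k, r)), [/\ forall i, S (row i V),
    row_free (map_mx (intr : int -> rat) V) &
    forall s, S s -> (map_mx (intr : int -> rat) s <= map_mx (intr : int -> rat) V)%MS].
Proof.
pose P k := `[< exists V : 'M[int]_(k, r), (forall i, S (row i V)) /\
  row_free (map_mx (intr : int -> rat) V) >].
have P0 : exists k, P k.
  exists 0%N; apply/asboolP; exists 0; split; first by case.
  by rewrite /row_free -leqn0 rank_leq_row.
have Pr k : P k -> (k <= r)%N.
  by move=> /asboolP[V [_ /eqP <-]]; exact: rank_leq_col.
have [k /asboolP[V [VS Vfree]] kmax] := ex_maxnP P0 Pr.
exists k, V; split=> // s Ss; apply: contraT => sV.
suff /kmax : P k.+1 by rewrite ltnn.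
have sVS (i : 'I_(1 + k)) : S (row i (col_mx s V)).
  by rewrite -(splitK i); case: (fintype.split i) => j; rewrite ?rowKu ?row_id ?rowKd.
suff sVfree : row_free (map_mx (intr : int -> rat) (col_mx s V)).
  by apply/asboolP; exists (col_mx s V : 'M[int]_(1 + k, r)).
rewrite map_col_mx /row_free eqn_leq rank_leq_row /= -addsmxE.
rewrite -[k in (k < _)%N](eqP Vfree) rank_ltmx // ltmxE addsmxSr /=.
by apply: contra sV => /(submx_trans _)->//; exact: addsmxSl.
Qed.

(** The map [f] takes the columns [J] of [x] modulo the rows of the square submatrix [M], so the
    size of [T] is the absolute value of [\det M], at most [D ^+ k]. Elements that are torsion
    modulo [lspan S] lie in the rational row space of [V], where the columns [J] determine a
    vector. *)
Lemma lattice_torsion_bound (R : realType) r (S : set 'rV[int]_r) (D : R) :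
  1 <= D -> (forall s, S s -> (\sum_i `|s 0 i|)%:~R <= D) ->
  exists (T : finType) (f : 'rV[int]_r -> T), #|T|%:R <= D ^+ r /\
    forall x y k l, (0 < k)%N -> (0 < l)%N -> lspan S (x *+ k) ->
      lspan S (y *+ l) -> f x = f y -> lspan S (x - y).
Proof.
move=> D1 SD; have [k [V [VS Vfree SV]]] := maximal_free_rows S.
pose Q m n (A : 'M[int]_(m, n)) := map_mx (intr : int -> rat) A.
have spanV x : lspan S x -> (Q _ _ x <= Q _ _ V)%MS.
  move=> Sx; have : lspan S `<=` [set x | (Q _ _ x <= Q _ _ V)%MS].
    apply: lspan_min => //; split=> [|a y z /= yV zV]; rewrite /Q /=.
      by rewrite map_mx0 sub0mx.
    by rewrite map_mxD map_mxZ addmx_sub // scalemx_sub.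
  exact.
have torsV x m : (0 < m)%N -> lspan S (x *+ m) -> (Q _ _ x <= Q _ _ V)%MS.
  move=> m0 /spanV; rewrite -scaler_nat /Q map_mxZ /=.
  by rewrite eqmx_scale // intr_eq0 pnatr_eq0 -lt0n.
have Vfull : row_full (Q _ _ V)^T by rewrite /row_full mxrank_tr.
(* The [k] columns [J] of [V] form a submatrix invertible over [rat]. *)
pose J := fullrankfun Vfull.
pose M := colsub J V.
have QM : Q _ _ M = (rowsub J (Q _ _ V)^T)^T by apply/matrixP => i j; rewrite !mxE.
have QMunit : Q _ _ M \in unitmx by rewrite QM unitmx_tr fullrowsub_unit.
have detM : \det M != 0.
  by move: QMunit; rewrite unitmxE det_map_mx unitfE intr_eq0.
have [T [f [cardT fP]]] := int_coker_count detM.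
exists T, (fun x => f (colsub J x)); split=> [|x y m l m0 l0 Sx Sy /fP[u xyu]].
  have kr : (k <= r)%N by rewrite -(eqP Vfree) rank_leq_col.
  apply: (@le_trans _ _ (D ^+ k)); last exact: ler_weXn2l.
  rewrite cardT -[_%:R]/((Posz `|\det M|)%:~R) abszE.
  apply: (@le_trans _ _ (\prod_(i < k) \sum_j `|M i j|)%:~R).
    by rewrite ler_int det_le_prod_norm.
  rewrite (big_morph intr (intrM R) (erefl _)) -[k in D ^+ k]card_ord -prodr_const.
  apply: ler_prod => i _; rewrite ler0z sumr_ge0 //=.
  apply: le_trans (SD _ (VS i)); rewrite ler_int.
  (* The chosen columns contribute only part of the l1-norm of a row of [V], and that row belongs to
     [S]. *)
  rewrite [leRHS](bigID [in [set J j | j : 'I_k]%SET]) /= big_imset /=; last first.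
    by move=> a b _ _; exact: fullrankfun_inj.
  rewrite [X in _ <= X + _](eq_bigr (fun j => `|M i j|)).
    by rewrite lerDl sumr_ge0.
  by move=> j _; rewrite !mxE.
(* The columns [J] of [z] vanish. Writing [z] as [w] times [V] over [rat] gives [w *m M = 0], hence
   [w = 0] and [z = 0]; so [x - y] is an integral combination of the rows of [V]. *)
pose z := x - y - u *m V.
have zV : (Q _ _ z <= Q _ _ V)%MS.
  rewrite /z /Q !map_mxB map_mxM.
  apply: addmx_sub; last by rewrite eqmx_opp submxMl.
  apply: addmx_sub; first exact: (torsV _ m).
  by rewrite eqmx_opp; exact: (torsV _ l).
have /submxP[w zw] := zV.
have wM : w *m Q _ _ M = 0.
  have -> : w *m Q _ _ M = colsub J (Q _ _ z).
    rewrite zw; apply/matrixP => i j; rewrite !mxE.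
    by apply: eq_bigr => a _; rewrite !mxE.
  have -> : colsub J (Q _ _ z) = Q _ _ (colsub J x - colsub J y - u *m M).
    apply/matrixP => i j; rewrite !mxE; congr ((_ - _)%:~R).
    by apply: eq_bigr => a _; rewrite !mxE.
  by rewrite xyu subrr /Q map_mx0.
have w0 : w = 0 by rewrite -[w](mulmxK QMunit) wM mul0mx.
have /subr0_eq -> : z = 0.
  apply/matrixP => i j; apply: (@intr_inj rat).
  by have /matrixP/(_ i j) := zw; rewrite w0 mul0mx !mxE.
rewrite mulmx_sum_row; apply: lspan_sum => i _.
by apply: lspanZ; apply: lspan_gen; exact: VS.
Qed.

(** * Homology and homotopy retracts *)

Lemma lspan_fset (R : nzRingType) (M : lmodType R) (B : set M) x :
  finite_set B -> lspan B x ->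
  exists c : M -> R, x = \sum_(b <- fset_set B) c b *: b.
Proof.
move=> fB /lspan_coord[c /is_coord_fset[U [UB cU ->]]]; exists c.
apply: big_fset_incl => [|b _ /cU ->]; last by rewrite scale0r.
by apply/fsubsetP => b /UB Bb; rewrite in_fset_set // mem_set.
Qed.

(** With more vectors than generators, the coefficient matrix has a nonzero left kernel vector,
    which is a linear relation among the [v i]. *)
Lemma independent_le (F : fieldType) (V : lmodType F) (T : set V) k (v : 'I_k -> V) :
  finite_set T -> (forall i, lspan T (v i)) ->
  (forall c : 'I_k -> F, \sum_i c i *: v i = 0 -> forall i, c i = 0) ->
  (k <= #|` fset_set T|)%N.
Proof.
move=> fT vT vfree; rewrite leqNgt; apply/negP => ltk.
pose c i := projT1 (cid (lspan_fset fT (vT i))).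
pose A : 'M[F]_(k, #|` fset_set T|) := \matrix_(i, j) c i (fset_set T)`_j.
have vE i : v i = \sum_j A i j *: (fset_set T)`_j.
  rewrite [LHS](projT2 (cid (lspan_fset fT (vT i)))) (big_nth 0) big_mkord.
  by apply: eq_bigr => j _; rewrite mxE.
have : ~~ row_free A.
  by apply: contraL ltk => /eqP <-; rewrite -leqNgt rank_leq_col.
rewrite -kermx_eq0 => /rowV0Pn[w /sub_kermxP wA /eqP]; apply.
apply/rowP => i; rewrite [RHS]mxE; apply: (vfree (fun i => w 0 i)).
under eq_bigr do rewrite vE scaler_sumr.
rewrite exchange_big big1 //= => j _.
under eq_bigr do rewrite scalerA.
by rewrite -scaler_suml; have /rowP/(_ j) := wA; rewrite !mxE => ->; rewrite scale0r.
Qed.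

Lemma counting_le_card (R : realType) (H : choiceType) (A : set H) (T : finType)
    (f : H -> T) : {in A &, injective f} -> (counting A <= (#|T|%:R)%:E :> \bar R)%E.
Proof.
move=> finj.
have fA : finite_set A.
  by rewrite -(eq_finite_set (inj_card_eq finj)); exact: finite_finset.
rewrite /counting asboolT // lee_fin ler_nat.
have <- : #|` fset_set (f @` A)| = #|` fset_set A|.
  rewrite fset_set_image // card_in_imfset // => x y.
  by rewrite !in_fset_set // => Ax Ay; exact: finj.
by rewrite -(card_uniqP (fset_uniq _)) max_card.
Qed.

Lemma int_basis_coordinates (R : realType) (M : lmodType int) (B : set M) :
  is_basis B -> finite_set B ->
  exists crd : {linear M -> 'rV[int]_(rank B)}, injective crd /\
    forall x, l1norm R B x = (\sum_i `|crd x 0 i|)%:~R.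
Proof.
move=> Bb fB; pose crd (x : M) : 'rV[int]_(rank B) :=
  \row_i basis_coord B x (fset_set B)`_i.
have crd_lin : linear crd.
  by move=> a x y; apply/rowP => i; rewrite !mxE basis_coord_linear.
pose crdL := GRing.isLinear.Build int M 'rV[int]_(rank B) *:%R crd crd_lin.
have outB x b : b \notin fset_set B -> basis_coord B x b = 0.
  rewrite in_fset_set // notin_setE => nBb; have [_ cB _] := basis_coordP Bb x.
  by apply/eqP/negPn/negP => /cB.
have subB : [set` fset_set B] `<=` B by rewrite fset_setK.
exists (HB.pack crd crdL : {linear M -> 'rV[int]_(rank B)}); split=> [x y xy|x] /=.
  rewrite (basis_coord_sum Bb (outB x) subB) (basis_coord_sum Bb (outB y) subB).
  rewrite [LHS](big_nth 0) [RHS](big_nth 0) !big_mkord; apply: eq_bigr => i _.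
  by have /rowP/(_ i) := xy; rewrite !mxE => ->.
rewrite /l1norm (fsum_fset subB) => [|b /outB ->]; last by rewrite normr0.
rewrite (big_nth 0) big_mkord; congr (_%:~R).
by apply: eq_bigr => i _; rewrite mxE.
Qed.

Section Homology.
Context (R : nzRingType) (X : chain_complex R) (j : int).

Let boundaries : set (X j) := range (bd X (j + 1) j).

(** The image of [bd] is already a submodule, so taking its span adds nothing. *)
Lemma boundary_piP x : quotm_pi boundaries x = 0 <-> boundaries x.
Proof.
rewrite -(linear0 (quotm_pi boundaries)) quotm_piP subr0; split=> [|Bx].
  apply: (lspan_min (A := boundaries)) => //.
  split=> [|a _ _ [y _ <-] [z _ <-]]; first by exists 0; rewrite ?linear0.
  by exists (a *: y + z); rewrite ?linearP.
exact: lspan_gen.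
Qed.

(** Homology classes become classes of cycles modulo boundaries, so later arguments can choose a
    cycle in [X j] instead of handling the kernel type. *)
Lemma homology_embedding :
  exists f : {linear homology X j -> quotm boundaries}, [/\ injective f,
    forall q, exists2 z, bd X j (j - 1) z = 0 & f q = quotm_pi boundaries z &
    forall z, bd X j (j - 1) z = 0 -> exists q, f q = quotm_pi boundaries z].
Proof.
pose g : {linear Defs.lker (bd X j (j - 1)) -> quotm boundaries} :=
  quotm_pi boundaries \o (val : Defs.lker (bd X j (j - 1)) -> X j).
have g0 z : (exists y, bd X (j + 1) j y = val z) -> g z = 0.
  by move=> [y yz]; apply/boundary_piP; exists y.
have fE z : quotm_lift g0 (quotm_pi _ z) = quotm_pi boundaries (val z).
  exact: quotm_liftE.
exists (quotm_lift g0); split=> [p q /eqP|q|z /eqP z0]; last first.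
- by exists (quotm_pi _ (@Lker _ _ _ (bd X j (j - 1)) z z0)); rewrite [LHS]fE.
-   have [z <-] := quotm_pi_surj q; exists (val z); last exact: fE.
  exact/eqP/(valP z).
rewrite -subr_eq0 -linearB => /eqP pq; apply/eqP; rewrite -subr_eq0; apply/eqP.
have [z zE] := quotm_pi_surj (p - q); move: pq; rewrite -zE => pq.
have /boundary_piP[y _ yz] : quotm_pi boundaries (val z) = 0.
  by rewrite -[RHS]pq; exact/esym/fE.
rewrite -[RHS](linear0 (quotm_pi _)); apply/quotm_piP; rewrite subr0.
by apply: lspan_gen; exists y.
Qed.

End Homology.

Section BaseChange.
Context (R S : nzRingType) (phi : {rmorphism R -> S}).
Implicit Types M N : lmodType R.

Lemma tensor_pi0 M (t : {malg S[M]}) :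
  tensor_rel phi t -> quotm_pi (tensor_rel phi (M := M)) t = 0.
Proof.
move=> tt; rewrite -(linear0 (quotm_pi (tensor_rel phi (M := M)))); apply/quotm_piP.
by rewrite subr0; apply: lspan_gen.
Qed.

Lemma tensorZl M a s (x : M) : tensor phi (a * s) x = a *: tensor phi s x.
Proof. by rewrite /tensor !linearZ /= scalerA. Qed.

Lemma tensorDr M s (x y : M) : tensor phi s (x + y) = tensor phi s x + tensor phi s y.
Proof.
rewrite -[s]mulr1 !tensorZl -scalerDr; congr (_ *: _).
rewrite /tensor !scale1r -linearD; apply/eqP; rewrite -subr_eq0 -linearB.
by apply/eqP; apply: tensor_pi0; left; exists x => //; exists y.
Qed.

Lemma tensorZr M s a (x : M) : tensor phi s (a *: x) = tensor phi (s * phi a) x.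
Proof.
rewrite -[s]mulr1 -mulrA mul1r !tensorZl; congr (_ *: _).
rewrite -[phi a]mulr1 tensorZl; apply/eqP; rewrite -subr_eq0.
rewrite /tensor -linearZ -linearB; apply/eqP; apply: tensor_pi0; right.
by exists a; [|exists x; [|rewrite !scale1r]].
Qed.

Lemma tensorB M s (x y : M) : tensor phi s (x - y) = tensor phi s x - tensor phi s y.
Proof.
apply: (addIr (tensor phi s y)).
by rewrite -tensorDr !subrK.
Qed.

Lemma base_change_map_comp M N (P Q : lmodType R) (f : {linear M -> N})
    (g : {linear N -> Q}) (f' : {linear M -> P}) (g' : {linear P -> Q}) u :
  (forall x, g (f x) = g' (f' x)) ->
  base_change_map phi g (base_change_map phi f u) =
  base_change_map phi g' (base_change_map phi f' u).
Proof.
move=> fg; elim/base_change_ind: u => [|u v fu fv|s x].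
- by rewrite !linear0.
- by rewrite !linearD fu fv.
- by rewrite !base_change_mapE fg.
Qed.

Lemma base_change_retract (X X' : chain_complex R) :
  homotopy_retract X X' ->
  homotopy_retract (base_change_complex phi X) (base_change_complex phi X').
Proof.
move=> h; pose F M N (f : {linear M -> N}) := base_change_map phi f.
apply: (@HomotopyRetract S (base_change_complex phi X) (base_change_complex phi X')
  (fun j => F _ _ (hr_to h j)) (fun j => F _ _ (hr_from h j))
  (fun i j => F _ _ (hr_htp h i j))).
- by move=> i j u; apply: base_change_map_comp => x; exact: hr_to_chain.
- by move=> i j u; apply: base_change_map_comp => x; exact: hr_from_chain.
move=> j u.
elim/base_change_ind: u => [|u v Hu Hv|s x].
- by rewrite !linear0 !addr0.
- by rewrite !linearD /= addrACA; apply: etrans (congr2 +%R Hu Hv) _; rewrite addrACA.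
by rewrite !base_change_mapE -tensorDr hr_htpP tensorB.
Qed.

End BaseChange.

Lemma counting_le_inj (R : realType) (S T : choiceType) (A : set S) (B : set T)
    (f : S -> T) : {in A &, injective f} -> (forall x, A x -> B (f x)) ->
  (counting A <= counting B :> \bar R)%E.
Proof.
move=> finj AB; have fAB : f @` A `<=` B by move=> _ [x Ax <-]; exact: AB.
rewrite [leRHS]/counting; case: asboolP => [fB|_]; last exact: leey.
have ffA : finite_set (f @` A) := sub_finite_set fAB fB.
have fA : finite_set A by rewrite -(eq_finite_set (inj_card_eq finj)).
rewrite /counting asboolT // lee_fin ler_nat.
have <- : #|` fset_set (f @` A)| = #|` fset_set A|.
  rewrite fset_set_image // card_in_imfset // => x y.
  by rewrite !in_fset_set // => Ax Ay; exact: finj.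
by apply: fsubset_leq_card; rewrite -fset_set_sub.
Qed.

Section Retract.
Context (A : nzRingType) (X X' : chain_complex A) (h : homotopy_retract X X').
Context (j : int).

(** For a cycle [z] the homotopy identity reads [bd (htp z) = z - from (to z)]. *)
Lemma retract_boundary z : bd X j (j - 1) z = 0 ->
  range (bd X (j + 1) j) (hr_from h j (hr_to h j z)) -> range (bd X (j + 1) j) z.
Proof.
move=> z0 [y _ yz]; exists (hr_htp h j (j + 1) z + y) => //.
by have := hr_htpP h z; rewrite z0 linear0 addr0 linearD yz => ->; rewrite subrK.
Qed.

Lemma retract_class z z' : bd X j (j - 1) z = 0 -> bd X j (j - 1) z' = 0 ->
  range (bd X (j + 1) j) (hr_from h j (hr_to h j z - hr_to h j z')) ->
  quotm_pi (range (bd X (j + 1) j)) z = quotm_pi (range (bd X (j + 1) j)) z'.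
Proof.
move=> z0 z0'; rewrite -linearB => bzz'.
apply/eqP; rewrite -subr_eq0 -linearB; apply/eqP/boundary_piP.
by apply: retract_boundary bzz'; rewrite linearB z0 z0' subrr.
Qed.

End Retract.

(** The map induced by [hr_to] is injective on homology, since [hr_from] carries boundaries back to
    boundaries, and it preserves torsion. Applied to resolutions, it transfers torsion bounds from
    one resolution to another. *)
Lemma retract_tors_card (R : realType) (X X' : chain_complex int) (j : int) :
  homotopy_retract X X' ->
  (tors_card R (homology X j) <= tors_card R (homology X' j))%E.
Proof.
move=> h; have [f [finj fz _]] := homology_embedding X j.
have [f' [finj' _ fz']] := homology_embedding X' j.
pose z q := projT1 (cid2 (fz q)).
have z0 q : bd X j (j - 1) (z q) = 0 by rewrite /z; case: cid2.
have zE q : f q = quotm_pi _ (z q) by rewrite /z; case: cid2.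
have gP q : exists p, f' p = quotm_pi _ (hr_to h j (z q)).
  by apply: fz'; rewrite hr_to_chain z0 linear0.
pose g q := projT1 (cid (gP q)).
have gE q : f' (g q) = quotm_pi _ (hr_to h j (z q)) := projT2 (cid (gP q)).
apply: (@counting_le_inj _ _ _ _ _ g) => [p q _ _ gpq|q [k k0 qk]].
  apply: finj; rewrite !zE; apply: (retract_class (h := h)) => //.
  have := congr1 f' gpq; rewrite !gE => /eqP; rewrite -subr_eq0 -linearB => /eqP.
  move=> /boundary_piP[y _ <-]; exists (hr_from h (j + 1) y) => //.
  exact: hr_from_chain.
exists k => //; apply: finj'; rewrite linear0 linearMn /= gE -linearMn.
apply/boundary_piP; have : f (q *+ k) = 0 by rewrite qk linear0.
rewrite linearMn /= zE -linearMn => /boundary_piP[y _ yz].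
by exists (hr_to h (j + 1) y) => //; rewrite hr_to_chain yz linearMn.
Qed.

(* Torsion classes of [H_j X] inject, through [hr_to], into the torsion of
   [X'_j / <S>]. *)
Lemma homology_tors_bound (R : realType) (X X' : chain_complex int)
    (h : homotopy_retract X X') (j : int) (B : set (X' j)) (S : set (X' j)) (D : R) :
  is_basis B -> finite_set B -> 1 <= D ->
  (forall s, S s -> l1norm R B s <= D) ->
  (forall y, lspan S (hr_to h j (bd X (j + 1) j y))) ->
  (forall s, S s -> range (bd X (j + 1) j) (hr_from h j s)) ->
  (tors_card R (homology X j) <= (D ^+ rank B)%:E)%E.
Proof.
move=> Bb fB D1 SD bdS Sbd.
have [crd [crd_inj crdE]] := int_basis_coordinates R Bb fB.
have [|T [g [cardT gP]]] := @lattice_torsion_bound R _ (crd @` S) D D1.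
  by move=> _ [s Ss <-]; rewrite -crdE; exact: SD.
have [f [finj fz _]] := homology_embedding X j.
pose z q := projT1 (cid2 (fz q)).
have z0 q : bd X j (j - 1) (z q) = 0 by rewrite /z; case: cid2.
have zE q : f q = quotm_pi _ (z q) by rewrite /z; case: cid2.
apply: (@le_trans _ _ (#|T|%:R%:E)); last by rewrite lee_fin.
have tors q k : q *+ k = 0 -> lspan (crd @` S) (crd (hr_to h j (z q)) *+ k).
  move=> qk; have : quotm_pi (range (bd X (j + 1) j)) (z q *+ k) = 0.
    by rewrite linearMn /= -zE -linearMn qk linear0.
  move=> /boundary_piP[y _ yz]; rewrite -!linearMn /= -yz.
  apply: lspan_map (bdS y); first exact: lspan_submodule.
  by move=> s Ss; apply: lspan_gen; exists s.
apply: (@counting_le_card _ _ _ _ (fun q => g (crd (hr_to h j (z q))))).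
move=> p q /set_mem[k k0 pk] /set_mem[l l0 ql] gpq.
apply: finj; rewrite !zE; apply: (retract_class (h := h)) => //.
have := gP _ _ _ _ k0 l0 (tors _ _ pk) (tors _ _ ql) gpq.
(* Injectivity of [crd] moves membership in the span from coordinate vectors back to [X' j];
   [hr_from] then sends the span of [S] into the boundaries. *)
rewrite -linearB => /lspan_image[x Sx /crd_inj <-].
apply: (lspan_map _ _ Sx) => //.
split=> [|a _ _ [y _ <-] [y' _ <-]]; first by exists 0; rewrite ?linear0.
by exists (a *: y + y'); rewrite ?linearP.
Qed.

(** A relation among the images under [hr_to] of representing cycles makes the same combination of
    the cycles a boundary. Independent classes therefore have independent images in the base change
    of [X' j], which is spanned by the images of [B]. *)
Lemma retract_dimension (R : realType) (F : fieldType) (X X' : chain_complex int)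
    (j : int) (B : set (X' j)) : homotopy_retract X X' -> is_basis B -> finite_set B ->
  (dimension R (homology (base_change_complex (intr : {rmorphism int -> F}) X) j) <=
   (rank B)%:R%:E)%E.
Proof.
move=> /(base_change_retract (intr : {rmorphism int -> F})) h Bb fB.
apply: ge_ereal_sup => _ [k [v vfree] <-]; rewrite lee_fin ler_nat.
set XF := base_change_complex _ X in h v vfree.
have [f [finj fz _]] := homology_embedding XF j.
pose z q := projT1 (cid2 (fz q)).
have z0 q : bd XF j (j - 1) (z q) = 0 by rewrite /z; case: cid2.
have zE q : f q = quotm_pi _ (z q) by rewrite /z; case: cid2.
pose t := tensor (intr : {rmorphism int -> F}) (M := X' j) 1.
have tB u : lspan (t @` B) u.
  elim/base_change_ind: u => [|u u' Bu Bu'|s x].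
  - exact: lspan0.
  - exact: lspanD.
  have : lspan (t @` B) (t x).
    have := basis_lspan Bb x; apply: (lspan_min (A := [set x | lspan (t @` B) (t x)])).
      split=> [|a y y' /= By By']; first by rewrite /= /t tensor0; exact: lspan0.
      by rewrite /t tensorDr tensorZr mulrC tensorZl; apply: lspanP.
    by move=> b Bb'; apply: lspan_gen; exists b.
  by move=> /(lspanZ s); rewrite /t -tensorZl mulr1.
apply: (@leq_trans #|` fset_set (t @` B)|); last first.
  by rewrite fset_set_image // /rank leq_imfset_card.
apply: (@independent_le _ _ _ _ (fun i => hr_to h j (z (v i)))) => //.
  exact: finite_image.
move=> c c0; apply: vfree; apply: finj; rewrite linear0 linear_sum.
under eq_bigr do rewrite linearZ /= zE -linearZ.
rewrite -linear_sum; apply/boundary_piP; apply: (retract_boundary (h := h)).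
  by rewrite linear_sum big1 // => i _; rewrite linearZZ z0 scaler0.
rewrite linear_sum; under eq_bigr do rewrite linearZZ.
by rewrite c0 linear0; exists 0; rewrite ?linear0.
Qed.

(** * Bases of coinvariants *)

Section BaseChangeBasis.
Context (R S : nzRingType) (phi : {rmorphism R -> S}) (M : lmodType R).

(** Universal property of the base change along [phi]. *)
Lemma base_change_lift (N : lmodType S) (f : M -> N) :
  (forall x y, f (x + y) = f x + f y) -> (forall a x, f (a *: x) = phi a *: f x) ->
  exists F : {linear base_change phi M -> N}, forall s x, F (tensor phi s x) = s *: f x.
Proof.
move=> fD fZ.
pose g : {linear {malg S[M]} -> N} := free_ext f.
have fE x : g << x >> = f x by rewrite [LHS]free_extU scale1r.
have g0 z : tensor_rel phi z -> g z = 0.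
  case=> [[x _ [y _ <-]]|[r _ [x _ <-]]].
    by rewrite linearB linearD !fE fD subrr.
  by rewrite linearB linearZ !fE fZ subrr.
exists (quotm_lift g0) => s x.
by rewrite [LHS]quotm_liftE linearZ /= fE.
Qed.

(** The functional dual to [tensor phi 1 b] is induced by [phi] applied to the coordinate at [b].
    These functionals also show that distinct basis elements stay distinct. *)
Lemma base_change_basis (B : set M) : is_basis B -> is_basis (tensor phi 1 @` B).
Proof.
move=> Bb; apply: is_basis_dual => [u|_ [b Bb0 <-]].
  elim/base_change_ind: u => [|u v|s x]; [exact: lspan0|exact: lspanD|].
  have := basis_lspan Bb x => /lspan_coord[c /is_coord_fset[U [UB _ ->]]].
  have -> (r : seq M) : tensor phi s (\sum_(b <- r) c b *: b) =
      \sum_(b <- r) (s * phi (c b)) *: tensor phi 1 b.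
    elim: r => [|b r IHr]; rewrite ?big_nil ?tensor0 // !big_cons -IHr.
    by rewrite tensorDr tensorZr -[in LHS](mulr1 (s * _)) tensorZl.
  rewrite big_seq; apply: lspan_sum => b /UB Bb'.
  by apply: lspanZ; apply: lspan_gen; exists b.
have [||F FE] := @base_change_lift S^o (fun x => phi (basis_coord B x b)).
- by move=> x y; rewrite basis_coordD // rmorphD.
- by move=> a x; rewrite basis_coordZ // rmorphM.
have FB b' : B b' -> F (tensor phi 1 b') = (b == b')%:R.
  by move=> Bb'; rewrite FE scale1r basis_coord_gen // rmorph_nat.
exists F => _ [b' Bb' <-]; rewrite FB //.
suff -> : (tensor phi 1 b == tensor phi 1 b') = (b == b') by [].
apply/eqP/eqP => [/(congr1 F)|-> //]; rewrite !FB // eqxx.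
by case: eqVneq => // _ /eqP; rewrite oner_eq0.
Qed.

End BaseChangeBasis.

Lemma group_ring_ind (G : groupType) (P : group_ring G -> Prop) :
  P 0 -> (forall x y, P x -> P y -> P (x - y)) -> (forall g, P (gr_of g)) ->
  forall x, P x.
Proof.
move=> P0 PB Pg; have PN x : P x -> P (- x) by move=> Px; rewrite -sub0r; apply: PB.
have PD x y : P x -> P y -> P (x + y) by move=> Px Py; rewrite -[y]opprK; apply/PB/PN.
have Pn n g : P << n%:Z *g g >>.
  elim: n => [|n IHn]; first by rewrite monalgU0.
  by rewrite -addn1 PoszD monalgUD; apply: PD => //; exact: Pg.
apply: gr_ind => // -[n|n] g; first exact: Pn.
by rewrite NegzE monalgUN; exact/PN/Pn.
Qed.

(** * Restriction of free modules to a subgroup *)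

Section Subgroup.
Context (G : groupType) (L : groupClosed G).

(** Representative of the right coset [L g]; the default [1] is never taken, because [g] itself
    qualifies. *)
Definition coset_rep (g : G) : G := xget 1%g [set x | (x * g^-1)%g \in (L : {pred G})].

Lemma coset_repP g : (coset_rep g * g^-1)%g \in (L : {pred G}).
Proof.
rewrite /coset_rep; case: xgetP => [x _ //|/(_ g)].
by rewrite /= mulgV gpred1.
Qed.

Lemma coset_rep_eq g h : (g * h^-1)%g \in (L : {pred G}) -> coset_rep g = coset_rep h.
Proof.
move=> gh; rewrite /coset_rep; congr xget; apply/funext => x; apply/propext.
by rewrite /= -(gpredMr (x / g)%g gh) mulgA mulgVK.
Qed.

(** The group ring of [G] is a free left module over that of [L], with one generator for each right
    coset. This is the coefficient at the generator [g]: it sends [l g] to [l] and kills the other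
    cosets. *)
Definition coset_coeff (g : G) : group_ring G -> group_ring (subgrp L) :=
  gr_lift (fun x => if insub (x * g^-1)%g is Some l then gr_of l else 0).

Lemma coset_coeffB g x y : coset_coeff g (x - y) = coset_coeff g x - coset_coeff g y.
Proof. exact: gr_lift_is_zmod_morphism. Qed.

Lemma coset_coeff0 g : coset_coeff g 0 = 0.
Proof. exact: gr_lift0. Qed.

Lemma coset_coeffD g x y : coset_coeff g (x + y) = coset_coeff g x + coset_coeff g y.
Proof. exact: gr_liftD. Qed.

Lemma gr_map_gr_of (l : subgrp L) :
  gr_map (@subgrp_val G L) (gr_of l) = gr_of (val l).
Proof. exact: gr_liftU. Qed.

Lemma coset_coeff_gr_of g x : coset_coeff g (gr_of x) =
  if insub (x * g^-1)%g is Some l then gr_of l else 0.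
Proof. exact: gr_liftU. Qed.

Lemma coset_coeffM g a x :
  coset_coeff g (gr_map (@subgrp_val G L) a * x) = a * coset_coeff g x.
Proof.
elim/group_ring_ind: a => [|a b IHa IHb|l].
- by rewrite rmorph0 !mul0r coset_coeff0.
- by rewrite rmorphB !mulrBl !coset_coeffB IHa IHb.
elim/group_ring_ind: x => [|a b IHa IHb|h].
- by rewrite !mulr0 !coset_coeff0 mulr0.
- by rewrite mulrBr !coset_coeffB IHa IHb mulrBr.
rewrite [gr_map _ _]gr_map_gr_of -gr_ofM !coset_coeff_gr_of -mulgA.
(* The two membership tests agree, since the left factor [l] lies in the subgroup. *)
case: insubP => [u|]; case: insubP => [v|].
- move=> _ vE _ uE; rewrite -gr_ofM; congr gr_of; apply: val_inj.
  by rewrite [RHS]/= -/(val _) uE -vE.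
- by move=> /negP nv lv; case: nv; move: lv; rewrite gpredMl //; exact: (valP l).
- by move=> v0 _ /negP[]; rewrite gpredMl //; exact: (valP l).
- by rewrite mulr0.
Qed.

Context (M : lmodType (group_ring G)) (B : set M).

Let resM := restr (gr_map (@subgrp_val G L)) M.

Definition restr_basis : set resM :=
  [set (gr_of (coset_rep g) *: b : M) | g in [set: G] & b in B].

Lemma restr_scaleE a (x : M) : a *: (x : resM) = (gr_map (@subgrp_val G L) a *: x : M).
Proof. by []. Qed.

Lemma gr_of_subgrp (g h : G) (gL : g \in (L : {pred G})) (x : M) :
  (gr_of (g * h)%g *: x : resM) = gr_of (Subgrp gL) *: (gr_of h *: x : resM).
Proof. by rewrite restr_scaleE [gr_map _ _]gr_map_gr_of scalerA -gr_ofM. Qed.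

(** Writing [g] as an element of [L] times [coset_rep g] gives generation; the dual functional is
    [coset_coeff] of the coordinate at [b]. *)
Lemma restr_is_basis : is_basis B -> is_basis restr_basis.
Proof.
move=> Bb; apply: is_basis_dual => [x|_ [g _ [b Bb0 <-]]].
  have gen a b : B b -> lspan restr_basis (a *: b : M).
    move=> Bb'; elim/group_ring_ind: a => [|a c IHa IHc|g].
    - by rewrite scale0r; exact: (lspan0 (M := resM)).
    - by rewrite scalerBl; exact: (lspanB (M := resM)).
    have gL : (g * (coset_rep g)^-1)%g \in (L : {pred G}).
      by rewrite gpredFC; exact: coset_repP.
    rewrite -[g](mulgVK (coset_rep g)) (gr_of_subgrp _ gL).
    by apply: lspanZ; apply: lspan_gen; exists g => //; exists b.
  have /lspan_coord[c /is_coord_fset[U [UB _ ->]]] := basis_lspan Bb x.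
  rewrite big_seq; apply: (lspan_sum (M := resM)) => b' /UB Bb'.
  exact: gen.
pose f (x : resM) : (group_ring (subgrp L))^o :=
  coset_coeff (coset_rep g) (basis_coord B (x : M) b).
have flin : linear f.
  by move=> a x y; rewrite /f basis_coordD // basis_coordZ // coset_coeffD coset_coeffM.
pose fL := GRing.isLinear.Build _ resM _ *:%R f flin.
pose F : {linear resM -> (group_ring (subgrp L))^o} := HB.pack f fL.
have FE h b' : B b' -> F (gr_of (coset_rep h) *: b' : M) =
    ((b == b') && (coset_rep g == coset_rep h))%:R.
  move=> Bb'; rewrite [LHS]/= /f.
  have -> : basis_coord B (gr_of (coset_rep h) *: b') b =
      gr_of (coset_rep h) * (b == b')%:R.
    by rewrite basis_coordZ // basis_coord_gen.
  have [_|_] := eqVneq b b'; last by rewrite mulr0 coset_coeff0.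
  rewrite mulr1 coset_coeff_gr_of; case: eqVneq => [->|gh].
    rewrite mulgV; case: insubP => [u _ u1|]; last by rewrite gpred1.
    by congr gr_of; exact: val_inj.
  case: insubP => // u hg _; case/eqP: gh.
  rewrite -[coset_rep g](@coset_rep_eq _ _ (coset_repP g)).
  rewrite -[coset_rep h](@coset_rep_eq _ _ (coset_repP h)).
  by apply: coset_rep_eq; rewrite gpredFC.
exists F => _ [h _ [b' Bb' <-]]; rewrite FE //.
set e := (b == b') && _.
suff -> : (gr_of (coset_rep g) *: b == gr_of (coset_rep h) *: b' :> resM) = e by [].
apply/eqP/idP => [/(congr1 F)|/andP[/eqP -> /eqP ->] //].
rewrite !FE // -/e !eqxx; case: e => // /eqP; by rewrite oner_eq0.
Qed.

End Subgroup.

Lemma card_fset_set_le_size (T : choiceType) (A : set T) (s : seq T) :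
  A `<=` [set` s] -> (#|` fset_set A| <= size s)%N.
Proof.
move=> As; apply: uniq_leq_size => // x.
by rewrite in_fset_set ?inE => [/As|] //; exact: sub_finite_set As _.
Qed.

Section Coinvariants.
Context (G : groupType) (L : groupClosed G) (X : chain_complex (group_ring G)) (j : int).

Local Notation pi1 := (tensor (@augmentation (subgrp L))
  (M := restr (gr_map (@subgrp_val G L)) (X j)) 1).

Lemma coinv_tensorM (g h : G) (x : X j) : g \in (L : {pred G}) ->
  pi1 (gr_of (g * h)%g *: x : X j) = pi1 (gr_of h *: x : X j).
Proof.
move=> gL; rewrite (gr_of_subgrp _ gL) tensorZr mul1r.
by congr (tensor _ _ _); rewrite [LHS]gr_liftU.
Qed.

(** Translation by [L] does not change the tensor, so coset representatives already give all
    elements of [coinv_basis]. Freeness then follows from restriction and base change. *)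
Lemma coinv_basisE (B : basis_family X) :
  coinv_basis L B j = pi1 @` restr_basis (L := L) (B j).
Proof.
have rep g (x : X j) : pi1 (gr_of g *: x : X j) = pi1 (gr_of (coset_rep L g) *: x : X j).
  by rewrite -[in RHS](mulgVK g (coset_rep L g)) coinv_tensorM // coset_repP.
apply/seteqP; split=> [_ [g _ [e Be <-]]|_ [_ [g _ [e Be <-]] <-]].
  exists (gr_of (coset_rep L g) *: e : X j); last by rewrite [RHS]rep.
  by exists g => //; exists e.
by exists g; [|exists e; [exact: Be|exact: rep]].
Qed.

Lemma coinv_is_basis (B : basis_family X) : is_basis (B j) -> is_basis (coinv_basis L B j).
Proof. by move=> Bb; rewrite coinv_basisE; apply/base_change_basis/restr_is_basis. Qed.

Lemma coinv_rank_le (B : basis_family X) :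
  (forall x y, x \in (L : {pred G}) -> (x ^ y)%g \in (L : {pred G})) ->
  finite_set (cosets L) -> finite_set (B j) ->
  (rank (coinv_basis L B j) <= subgroup_index L * rank (B j))%N.
Proof.
move=> Lnormal fL fB.
pose t (p : set G * X j) : coinv L X j := pi1 (gr_of (xget 1%g p.1) *: p.2 : X j).
have sub : coinv_basis L B j `<=` t @` (cosets L `*` B j).
  move=> _ [g _ [e Be <-]].
  pose C := [set (g * y)%g | y in [set y | y \in (L : {pred G})]].
  exists (C, e); first by split=> //; exists g.
  rewrite /t /=; case: xgetP => [_ _ [y /= yL <-]|/(_ g)]; last first.
    by case; exists 1%g; rewrite /= ?gpred1 ?mulg1.
  (* [cosets] consists of left cosets, whereas the tensor identifies elements of a right coset;
     normality turns [g * y] into an element of [L] times [g]. *)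
  have -> : (g * y = (y ^ g^-1) * g)%g by rewrite conjgE invgK mulgA mulgVK.
  by apply: coinv_tensorM; exact: Lnormal.
pose s := [seq t (C, e) | C <- fset_set (cosets L), e <- fset_set (B j)].
rewrite /rank /subgroup_index -(size_allpairs (fun C e => t (C, e))).
apply: card_fset_set_le_size => u /sub[[C e] [/= LC Be] <-].
by apply/allpairsP; exists (C, e); rewrite /= !in_fset_set // !mem_set.
Qed.

(** Generators over the group ring are translated by all of [G] in order to generate over [int]
    after passing to coinvariants. *)
Lemma coinv_boundary_gens (s : seq (X j)) :
  range (bd X (j + 1) j) `<=` lspan [set` s] ->
  forall y : coinv L X (j + 1),
    lspan [set pi1 (gr_of g *: x : X j) | g in [set: G] & x in [set` s]]
      (bd (coinv L X) (j + 1) j y).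
Proof.
move=> bds; set S := [set _ | _ in _ & _ in _].
have Sgen x : lspan [set` s] x -> forall a, lspan S (pi1 (a *: x : X j)).
  apply: (lspan_min (A := [set x | forall a, lspan S (pi1 (a *: x : X j))])).
    split=> [a|a y z /= yS zS b]; first by rewrite scaler0 tensor0; exact: lspan0.
    rewrite scalerDr scalerA.
    by rewrite (tensorDr _ (M := restr (gr_map (@subgrp_val G L)) (X j))); exact: lspanD.
  move=> y ys a; elim/group_ring_ind: a => [|a b IHa IHb|g].
  - by rewrite scale0r tensor0; exact: lspan0.
  - rewrite scalerBl (tensorB _ (M := restr (gr_map (@subgrp_val G L)) (X j))).
    exact: (lspanB IHa IHb).
  - by apply: lspan_gen; exists g => //; exists y.
elim/base_change_ind => [|u v Su Sv|t y].
- by rewrite linear0; exact: lspan0.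
- by rewrite linearD; exact: lspanD.
rewrite base_change_mapE -[t]mulr1 tensorZl; apply: lspanZ.
rewrite -[X in tensor _ 1 X](scale1r (bd X (j + 1) j y : X j)).
by apply: Sgen; apply: bds; exists y.
Qed.

Lemma coinv_boundary (g : G) (x : X j) : range (bd X (j + 1) j) x ->
  range (bd (coinv L X) (j + 1) j) (pi1 (gr_of g *: x : X j)).
Proof.
move=> [y _ <-]; exists (tensor (@augmentation (subgrp L)) 1
  (gr_of g *: y : restr (gr_map (@subgrp_val G L)) (X (j + 1)))) => //.
by rewrite [LHS]base_change_mapE; congr (tensor _ _ _); exact: linearZ.
Qed.

End Coinvariants.

Lemma group_ring_basis_ind (G : groupType) (M : lmodType (group_ring G)) (B : set M)
    (P : M -> Prop) : is_basis B -> P 0 -> (forall x y, P x -> P y -> P (x - y)) ->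
  (forall g b, B b -> P (gr_of g *: b)) -> forall x, P x.
Proof.
move=> Bb P0 PB Pg x.
have PD y z : P y -> P z -> P (y + z).
  by move=> Py Pz; have := PB y (0 - z) Py (PB 0 z P0 Pz); rewrite sub0r opprK.
have /lspan_coord[c /is_coord_fset[U [UB _ ->]]] := basis_lspan Bb x.
rewrite big_seq; elim/big_ind: _ => // b /UB Bb'.
elim/group_ring_ind: (c b) => [|a a' Pa Pa'|h]; rewrite ?scale0r ?scalerBl //.
- exact: PB.
- exact: Pg.
Qed.

(** [K] counts, with multiplicity, signed translates of basis elements that add up to [x].
    Translation by [g] keeps this count, so [K] is fixed before [L], [nu], [Q] and [g]. The intended
    [nu] is the l1-norm after [hr_to]. *)
Lemma coinv_seminorm_bound (R : realType) (G : groupType)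
    (X : chain_complex (group_ring G))
    (j : int) (B : basis_family X) (x : X j) : is_basis (B j) ->
  exists K : nat, forall (L : groupClosed G) (nu : coinv L X j -> R) (Q : R),
    nu 0 = 0 -> (forall u v, nu (u - v) <= nu u + nu v) ->
    (forall b, coinv_basis L B j b -> nu b <= Q) -> forall g : G,
    nu (tensor (@augmentation (subgrp L)) 1
      (gr_of g *: x : restr (gr_map (@subgrp_val G L)) (X j))) <= K%:R * Q.
Proof.
move=> Bb; move: x; apply: (group_ring_basis_ind Bb) => [|y z [K yK] [K' zK']|h b Bb'].
- by exists 0%N => L nu Q nu0 _ _ g; rewrite scaler0 tensor0 nu0 mul0r.
- exists (K + K')%N => L nu Q nu0 nuB nuQ g.
  rewrite scalerBr (tensorB _ (M := restr (gr_map (@subgrp_val G L)) (X j))).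
  by apply: le_trans (nuB _ _) _; rewrite natrD mulrDl lerD ?yK ?zK'.
exists 1%N => L nu Q nu0 nuB nuQ g; rewrite mul1r; apply: nuQ.
exists (g * h)%g; [by []|exists b; [exact: Bb'|]].
by rewrite gr_ofM scalerA.
Qed.

(** * The l1-norm and operator norms on basis vectors *)

Section Norms.
Context (R : realType) (M N : lmodType int) (B : set M) (C : set N).
Context (Bb : is_basis B).

Lemma l1norm_gen b : B b -> l1norm R B b = 1.
Proof.
move=> Bb0; rewrite /l1norm (@fsum_fset _ _ B [fset b]%fset).
- by rewrite big_seq_fset1 basis_coord_gen // eqxx.
- by move=> b'; rewrite /= inE => /eqP ->.
- by move=> b'; rewrite inE basis_coord_gen // => /negbTE ->.
Qed.

Lemma opnorm_gen (f : {linear M -> N}) (c : R) b :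
  (opnorm R B C f <= c%:E)%E -> B b -> l1norm R C (f b) <= c.
Proof.
move=> fc Bb0; rewrite -lee_fin; apply: le_trans fc; apply: ereal_sup_ubound.
by exists b => //; rewrite l1norm_gen // divr1.
Qed.

Lemma l1norm0 : l1norm R B 0 = 0.
Proof.
by rewrite /l1norm (basis_coord_unique Bb (is_coord0 B)) fsbig1 // normr0.
Qed.

Lemma l1normB x y : finite_set B -> l1norm R B (x - y) <= l1norm R B x + l1norm R B y.
Proof.
move=> fB; have [crd [_ crdE]] := int_basis_coordinates R Bb fB.
rewrite !crdE -intrD ler_int -big_split /=; apply: ler_sum => i _.
by rewrite linearB !mxE ler_normB.
Qed.

End Norms.

(** * Comparison of projective resolutions *)

(** Dependent choice in a family of types: the invariant [P] makes the next choice possible and [S]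
    relates successive ones. It builds chain maps and homotopies degree by degree. *)
Lemma dependent_sequence (T : nat -> Type) (P : forall k, T k -> Prop)
    (S : forall k, T k -> T k.+1 -> Prop) (t0 : T 0%N) : P 0%N t0 ->
  (forall k t, P k t -> exists t', P k.+1 t' /\ S k t t') ->
  exists t : forall k, T k, t 0%N = t0 /\ forall k, S k (t k) (t k.+1).
Proof.
move=> P0 next.
pose F := fix F k : {t : T k | P k t} := match k with
  | 0%N => exist _ t0 P0
  | k'.+1 => let t' := cid (next k' _ (projT2 (F k'))) in
    exist _ (projT1 t') (projT2 t').1
  end.
exists (fun k => projT1 (F k)); split=> // k.
exact: (projT2 (cid (next k _ (projT2 (F k))))).2.
Qed.

Section Comparison.
Context (R : nzRingType).

(* The lift factors through the pullback of [f] and [g]. *)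
Lemma projective_lift (P M N : lmodType R) (g : {linear M -> N}) (f : {linear P -> N}) :
  projective P -> (forall x, exists y, g y = f x) ->
  exists h : {linear P -> M}, forall x, g (h x) = f x.
Proof.
move=> projP gf.
pose d (u : P * M) : N := f u.1 - g u.2.
have dlin : linear d.
  by move=> a u v; rewrite /d /= (linearP f) (linearP g) scalerBr opprD addrACA.
pose dL := GRing.isLinear.Build R (P * M)%type N *:%R d dlin.
pose D : {linear (P * M)%type -> N} := HB.pack d dL.
pose fstD : {linear Defs.lker D -> P} := fst \o (val : Defs.lker D -> P * M).
have [x|h hE] := projP _ _ fstD idfun.
  have [y yx] := gf x; have xy : (x, y) \in lker_pred D.
    by apply/eqP; rewrite /= /d /= yx subrr.
  by exists (Lker xy).
exists (snd \o (val : Defs.lker D -> P * M) \o h) => x /=.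
have := valP (h x) => /eqP; rewrite /= /d => /eqP; rewrite subr_eq0 => /eqP <-.
by congr (f _); exact: hE.
Qed.

(** A form of [projective_resolution] with fixed augmentation and with degrees written [Posz k.+1],
    so that induction on [k] avoids integer arithmetic in the types. *)
Record resolution (P : chain_complex R) (M : lmodType R)
    (eps : {linear P 0 -> M}) : Prop :=
  Resolution {
    res_proj : forall j, projective (P j);
    res_neg : forall (k : nat) (x : P (Negz k)), x = 0;
    res_surj : forall m, exists x, eps x = m;
    res_exact0 : forall x, eps x = 0 <-> exists y, bd P (Posz 1) (Posz 0) y = x;
    res_exactS : forall (k : nat) (x : P (Posz k.+1)), bd P (Posz k.+1) (Posz k) x = 0 ->
      exists y, bd P (Posz k.+2) (Posz k.+1) y = x }.

Lemma projective_resolutionE (P : chain_complex R) (M : lmodType R) :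
  projective_resolution P M -> exists eps : {linear P 0 -> M}, resolution eps.
Proof.
move=> [Pproj Pneg [eps [eps_surj eps0 Pex]]]; exists eps; split=> //.
  by move=> k x; apply: Pneg.
move=> k; have := Pex (Posz k.+1).
have -> : Posz k.+1 - 1 = Posz k by rewrite -addn1 PoszD addrK.
have -> : Posz k.+1 + 1 = Posz k.+2 by rewrite -PoszD addn1.
by move=> ex x; exact: ex.
Qed.

Lemma neg_degree (P : chain_complex R) (M : lmodType R) (eps : {linear P 0 -> M}) :
  resolution eps -> forall j (x : P j), j < 0 -> x = 0.
Proof. by move=> rP [k|k] x // _; exact: (res_neg rP). Qed.

Context (P Q : chain_complex R) (M : lmodType R).
Context (epsP : {linear P 0 -> M}) (epsQ : {linear Q 0 -> M}).
Hypotheses (rP : resolution epsP) (rQ : resolution epsQ).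

Lemma chain_map_lift : exists f : forall j, {linear P j -> Q j},
  (forall i j x, bd Q i j (f i x) = f j (bd P i j x)) /\
  forall x, epsQ (f 0 x) = epsP x.
Proof.
have [|f0 f0E] := projective_lift (g := epsQ) (f := epsP) (res_proj rP (j := 0)).
  by move=> x; exact: (res_surj rQ).
pose T k := {linear P (Posz k) -> Q (Posz k)}.
(* The invariant allows the lift in the next degree. It propagates by exactness of [Q], because [bd]
   kills the new map composed with [bd]. *)
pose liftable k (t : T k) := forall x, exists y,
  bd Q (Posz k.+1) (Posz k) y = t (bd P (Posz k.+1) (Posz k) x).
pose compat k (t : T k) (t' : T k.+1) := forall x,
  bd Q (Posz k.+1) (Posz k) (t' x) = t (bd P (Posz k.+1) (Posz k) x).
have [||t [t0 tS]] := @dependent_sequence T liftable compat f0.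
- move=> x; apply/(res_exact0 rQ); rewrite f0E.
  by apply/(res_exact0 rP); exists x.
- move=> k t tl.
  have [t' t'E] := projective_lift (g := bd Q (Posz k.+1) (Posz k))
    (f := t \o bd P (Posz k.+1) (Posz k)) (res_proj rP (j := _)) tl.
  exists t'; split=> // x; apply: (res_exactS rQ).
  by rewrite t'E /= bd_bd linear0.
pose f j : {linear P j -> Q j} := match j with Posz k => t k | Negz k => \0 end.
exists f; split=> [i j x|x]; last by rewrite -f0E -t0.
have [ij|ij] := eqVneq i (j + 1); last by rewrite !bd_shape // linear0.
case: j ij => [j|j] ij; last by rewrite [LHS](res_neg rQ) [RHS](res_neg rQ).
subst i; have e : Posz j + 1 = Posz j.+1 by rewrite -PoszD addn1.
by move: x; rewrite e => x; exact: tS.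
Qed.

(** The values of [phi 0] are boundaries, so [s0] lifts it. In each further degree the next map
    lifts [phi] minus the previous map after [bd], whose values are cycles and hence boundaries. *)
Lemma null_homotopy (phi : forall j, {linear P j -> Q j}) :
  (forall i j x, bd Q i j (phi i x) = phi j (bd P i j x)) ->
  (forall x, epsQ (phi 0 x) = 0) ->
  exists s : forall i j, {linear P i -> Q j}, forall j x,
    bd Q (j + 1) j (s j (j + 1) x) + s (j - 1) j (bd P j (j - 1) x) = phi j x.
Proof.
move=> phi_chain phi_eps.
have [|s0 s0E] := projective_lift (g := bd Q (Posz 1) (Posz 0)) (f := phi 0)
    (res_proj rP (j := 0)).
  by move=> x; apply/(res_exact0 rQ).
pose T k := {linear P (Posz k) -> Q (Posz k.+1)}.
pose bQ k := bd Q (Posz k.+1) (Posz k).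
pose bP k := bd P (Posz k.+1) (Posz k).
(* The term with the previous map vanishes on boundaries, so the invariant can mention the current
   map alone. *)
pose liftable k (t : T k) := forall x, bQ k (t (bP k x)) = phi (Posz k) (bP k x).
pose compat k (t : T k) (t' : T k.+1) := forall x,
  bQ k.+1 (t' x) = phi (Posz k.+1) x - t (bP k x).
have [||t [t0 tS]] := @dependent_sequence T liftable compat s0.
- by move=> x; exact: s0E.
- move=> k t tl; pose d x := phi (Posz k.+1) x - t (bP k x).
  have dlin : linear d.
    by move=> a u v; rewrite /d (linearP (phi _)) (linearP (bP k)) (linearP t)
      scalerBr opprD addrACA.
  pose dL := GRing.isLinear.Build R _ _ *:%R d dlin.
  pose D : {linear P (Posz k.+1) -> Q (Posz k.+1)} := HB.pack d dL.
  have [|t' t'E] := projective_lift (g := bQ k.+1) (f := D) (res_proj rP (j := _)).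
    move=> x; apply: (res_exactS rQ); rewrite /= /d linearB /=.
    by rewrite -/(bQ k) tl phi_chain subrr.
  exists t'; split=> x; rewrite t'E /= /d //.
  by rewrite /bP bd_bd linear0 subr0.
(* The two degrees of a homotopy are independent indices: [t k] is transported to [l = k.+1], and
   every other pair receives zero. *)
pose sN k l : {linear P (Posz k) -> Q (Posz l)} :=
  match @eqP _ k.+1 l with
  | ReflectT e => ecast l {linear P (Posz k) -> Q (Posz l)} e (t k)
  | ReflectF _ => \0
  end.
pose s i j : {linear P i -> Q j} :=
  match i, j with Posz k, Posz l => sN k l | _, _ => \0 end.
have sE k x : sN k k.+1 x = t k x.
  by rewrite /sN; case: eqP => // e; rewrite (eq_irrelevance e erefl).
exists s => -[k|k] x; last by rewrite [LHS](res_neg rQ) [RHS](res_neg rQ).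
have -> : Posz k + 1 = Posz k.+1 by rewrite -PoszD addn1.
rewrite [s (Posz k) (Posz k.+1) x]sE; case: k x => [|k] x.
  (* [P] vanishes in degree -1, so only the first summand remains. *)
  rewrite (neg_degree rP (bd P 0 (0 - 1) x)) // linear0 addr0.
  by rewrite t0 s0E.
have -> : Posz k.+1 - 1 = Posz k by rewrite -addn1 PoszD addrK.
by rewrite [s _ _ _]sE [bd Q _ _ _]tS subrK.
Qed.

End Comparison.

(** Lifting the identity of [M] in both directions gives [f] and [g]. The identity minus [g] after
    [f] is annihilated by the augmentation in degree 0, hence null-homotopic. *)
Lemma projective_resolution_retract (R : nzRingType) (P Q : chain_complex R)
    (M : lmodType R) :
  projective_resolution P M -> projective_resolution Q M ->
  inhabited (homotopy_retract P Q).
Proof.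
move=> /projective_resolutionE[epsP rP] /projective_resolutionE[epsQ rQ].
have [f [f_chain f_eps]] := chain_map_lift rP rQ.
have [g [g_chain g_eps]] := chain_map_lift rQ rP.
have phi_lin j : linear (fun x : P j => x - g j (f j x)).
  by move=> a u v; rewrite (linearP (f j)) (linearP (g j)) scalerBr opprD addrACA.
pose phi j : {linear P j -> P j} := HB.pack (fun x : P j => x - g j (f j x))
  (GRing.isLinear.Build R (P j) (P j) *:%R _ (phi_lin j)).
have [|x|s sE] := null_homotopy rP rP (phi := phi).
- by move=> i j x; rewrite /= linearB g_chain f_chain.
- by rewrite /= linearB /= g_eps f_eps subrr.
by exists; exact: (HomotopyRetract f_chain g_chain sE).
Qed.

(** * Growth along residual chains *)

Lemma limn_esup_eq0 (R : realType) (u : nat -> \bar R) :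
  (forall i, (0 <= u i)%E) ->
  (forall e : R, 0 < e -> exists i0, forall i, (i0 <= i)%N -> (u i <= e%:E)%E) ->
  limn_esup u = 0%E.
Proof.
move=> u0 ue; apply/eqP; rewrite eq_le; apply/andP; split; last first.
  by apply: limf_esup_ge0 => //; exact: filter_not_empty.
apply/lee_addgt0Pr => e e0; rewrite add0e; have [i0 ui] := ue e e0.
apply: (@le_trans _ _ (ereal_sup (u @` [set i | (i0 <= i)%N]))).
  by apply: ereal_inf_lbound; exists [set i | (i0 <= i)%N] => //; exists i0.
by apply: ge_ereal_sup => _ [i /= i0i <-]; exact: ui.
Qed.

Lemma lee_div_EFin (R : realType) (x : \bar R) (r y : R) : 0 < r ->
  (x <= (y * r)%:E)%E -> (x / r%:E <= y%:E)%E.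
Proof. by move=> r0 xyr; rewrite inver gt_eqF // lee_pdivrMr // -EFinM. Qed.

(** With [T = s ^+ 2] one has [ln T = 2 ln s <= 2 s], so the bracket is at most [s (a + 2 b)]; the
    choice of [s] bounds this by [s ^+ 2] times [e]. *)
Lemma log_over_linear_small (R : realType) (a b e : R) : 0 <= a -> 0 <= b -> 0 < e ->
  exists2 T : R, 1 <= T & T^-1 * (a + b * ln T) <= e.
Proof.
move=> a0 b0 e0; pose s := Num.max 1 ((a + 2 * b) / e).
have s1 : 1 <= s by rewrite le_max lexx.
have s0 : 0 < s by exact: lt_le_trans s1.
exists (s ^+ 2); first exact: exprn_ege1.
rewrite lnXn // ler_pdivrMl ?exprn_gt0 //.
have lns : ln s <= s by exact/ltW/ln_sublinear.
have abs : a + 2 * b <= s * e.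
  by rewrite -ler_pdivrMr // le_max lexx orbT.
apply: (@le_trans _ _ (s * (a + 2 * b))).
  by have := ler_peMl a0 s1; have := ler_wpM2l b0 lns; lra.
by rewrite expr2 -mulrA ler_pM2l.
Qed.

Section Growth.
Context (R : realType) (G : groupType).

Lemma subgroup_index_gt0 (L : groupClosed G) :
  finite_set (cosets L) -> (0 < subgroup_index L)%N.
Proof.
move=> fL; rewrite /subgroup_index cardfs_gt0; apply/fset0Pn.
exists [set (1 * y)%g | y in [set y | y \in (L : {pred G})]].
by rewrite in_fset_set // mem_set //; exists 1%g.
Qed.

(** The zero class is torsion; this keeps the logarithms nonnegative. *)
Lemma tors_card_ge1 (M : lmodType int) : (1 <= tors_card R M)%E.
Proof.
rewrite /tors_card /counting; case: asboolP => [fT|_]; last exact: leey.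
rewrite lee_fin ler1n cardfs_gt0; apply/fset0Pn; exists 0.
by rewrite in_fset_set // mem_set //; exists 1%N.
Qed.

(** The logarithm of the bound is [r (ln K + kappa + kappa ln T)]. Since [K] and [kappa] are fixed
    before [T], a suitable [T] brings it below [e] times the index. [tau] is abstract so as to cover
    the torsion of coinvariants and of group homology alike. *)
Lemma limn_esup_lne_eq0 (X : chain_complex (group_ring G)) (B : basis_family X) (j : int)
    (tau : groupClosed G -> \bar R) (K kappa : R) (L : nat -> groupClosed G) :
  finite_set (B j) -> residual_chain L -> 1 <= K -> 1 <= kappa ->
  (forall L, (1 <= tau L)%E) ->
  (forall T : R, 1 <= T -> exists i0, forall i, (i0 <= i)%N -> exists2 r : nat,
    r%:R <= kappa * T^-1 * (rank (coinv_basis (L i) B j))%:R &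
    (tau (L i) <= ((K * (expR kappa * T `^ kappa)) ^+ r)%:E)%E) ->
  limn_esup (fun i => lne (tau (L i)) / (subgroup_index (L i))%:R%:E)%E = 0%E.
Proof.
move=> fB [_ _ Lnormal Lfin _] K1 k1 tau1 tauT.
have idx i : 0 < (subgroup_index (L i))%:R :> R by rewrite ltr0n subgroup_index_gt0.
apply: limn_esup_eq0 => [i|e e0].
  by rewrite mule_ge0 // ?lne_ge0 // inve_ge0 lee_fin ltW.
have k0 : 0 <= kappa by exact: le_trans k1.
have K0 : 0 < K by exact: lt_le_trans K1.
have lnK0 : 0 <= ln K by exact: ln_ge0.
(* Relative to the index, [r] is at most [c / T]. *)
pose c := kappa * (rank (B j))%:R.
have c0 : 0 <= c by rewrite mulr_ge0.
have [|||T T1 Te] := @log_over_linear_small R (c * (ln K + kappa)) (c * kappa) e.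
- by rewrite mulr_ge0 // addr_ge0.
- by rewrite mulr_ge0.
- by [].
have T0 : 0 < T by exact: lt_le_trans T1.
have [i0 tau_i] := tauT T T1; exists i0 => i /tau_i[r rle tau_le].
have D0 : 0 < K * (expR kappa * T `^ kappa).
  by rewrite !mulr_gt0 ?expR_gt0 ?powR_gt0.
apply: lee_div_EFin => //.
apply: (@le_trans _ _ (lne ((K * (expR kappa * T `^ kappa)) ^+ r)%:E)).
  rewrite lee_lne // in_itv /= leey andbT; first by apply: le_trans (tau1 _).
  by rewrite lee_fin exprn_ge0 // ltW.
rewrite lne_EFin ?exprn_gt0 // lee_fin lnXn //.
rewrite lnM ?posrE ?mulr_gt0 ?expR_gt0 ?powR_gt0 //.
rewrite lnM ?posrE ?expR_gt0 ?powR_gt0 // expRK ln_powR.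
have lnT0 : 0 <= ln T by exact: ln_ge0.
set l := ln K + _; have l0 : 0 <= l by rewrite !addr_ge0 // mulr_ge0.
rewrite -[l *+ r]mulr_natl.
apply: (@le_trans _ _ (kappa * T^-1 * (subgroup_index (L i) * rank (B j))%:R * l)).
  apply: ler_wpM2r => //; apply: le_trans rle _; apply: ler_wpM2l.
    by rewrite mulr_ge0 // invr_ge0 ltW.
  by rewrite ler_nat coinv_rank_le //; exact: Lnormal.
rewrite natrM; apply: le_trans (ler_wpM2r (ltW (idx i)) Te).
by rewrite le_eqVlt; apply/orP; left; apply/eqP; rewrite /c /l; ring.
Qed.

(** The translated boundary generators have images under [hr_to] of norm at most [K] times the
    operator norm bound, where [K] depends only on the generators [s] and the basis. *)
Lemma rebuilding_tors_bound (X : chain_complex (group_ring G)) (B : basis_family X)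
    (n j : int) (s : seq (X j)) : j <= n -> is_basis (B j) ->
  (forall x, x \in s -> range (bd X (j + 1) j) x) ->
  range (bd X (j + 1) j) `<=` lspan [set` s] ->
  exists2 K : R, 1 <= K & forall (L : groupClosed G) (kappa T : R),
    1 <= kappa -> 1 <= T -> admits_weak_rebuilding n T kappa (coinv_basis L B) ->
    exists2 r : nat, r%:R <= kappa * T^-1 * (rank (coinv_basis L B j))%:R &
    (tors_card R (homology (coinv L X) j) <=
      ((K * (expR kappa * T `^ kappa)) ^+ r)%:E)%E.
Proof.
move=> jn Bb sbd bds.
have Kx (x : X j) := coinv_seminorm_bound R x Bb.
(* The sum dominates the constant of each generator, and the successor ensures that the total is at
   least 1. *)
pose N := (\sum_(x <- s) projT1 (cid (Kx x))).+1.
exists N%:R; first by rewrite ler1n.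
move=> L kappa T k1 T1 [X' [B' [h [[Bb' fg' rk] /(_ j jn)[_ hQ]]]]].
set Q := expR kappa * T `^ kappa in hQ *.
have fB' := basis_finite (Bb' j) (fg' j jn).
have Q1 : 1 <= Q.
  rewrite mulr_ege1 //; first by rewrite -expR0 ler_expR (le_trans _ k1).
  by rewrite -(powRr0 T) ler_powR // (le_trans _ k1).
exists (rank (B' j)); first exact: rk.
pose S0 : set (coinv L X j) := [set tensor (@augmentation (subgrp L)) 1
  (gr_of g *: x : restr (gr_map (@subgrp_val G L)) (X j)) | g in [set: G] & x in [set` s]].
apply: (@homology_tors_bound _ _ _ h j (B' j) (hr_to h j @` S0)) => //.
- by rewrite mulr_ege1 // ler1n.
- move=> _ [_ [g _ [x xs <-]] <-].
  apply: (@le_trans _ _ ((projT1 (cid (Kx x)))%:R * Q)); last first.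
    rewrite ler_pM2r ?(lt_le_trans _ Q1) // ler_nat leqW //.
    by rewrite (big_rem x) //= leq_addr.
  (* The function bounded here is the l1-norm after [hr_to]; the operator norm bounds it by [Q] on
     basis elements. *)
  apply: (projT2 (cid (Kx x)) L (fun u => l1norm R (B' j) (hr_to h j u)) Q).
  + by rewrite linear0 l1norm0.
  + by move=> u v; rewrite linearB l1normB.
  + by move=> b Bb0; apply: opnorm_gen hQ Bb0; exact: coinv_is_basis.
- move=> y; apply: lspan_map (coinv_boundary_gens bds y); first exact: lspan_submodule.
  by move=> t St; apply: lspan_gen; exists t.
- move=> _ [_ [g _ [x xs <-]] <-].
  have [y _ <-] := coinv_boundary L g (sbd x xs).
  exists (hr_from h (j + 1) (hr_to h (j + 1) y)) => //.
  by rewrite hr_from_chain hr_to_chain.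
Qed.

End Growth.

(** * Vanishing of homology growth and of torsion growth *)

Lemma CD_Hvanish (R : realType) (G : groupType) (n : int)
    (X : chain_complex (group_ring G)) (F : fieldType) : CD R n X -> Hvanish R n F X.
Proof.
move=> [B [Bb fgX [kappa k1 H]]] L Lres j jn.
have fB := basis_finite (Bb j) (fgX j jn).
have [_ _ Lnormal Lfin _] := Lres.
have idx i : 0 < (subgroup_index (L i))%:R :> R by rewrite ltr0n subgroup_index_gt0.
apply: limn_esup_eq0 => [i|e e0].
  apply: mule_ge0; last by rewrite inve_ge0 lee_fin ltW.
  by apply: ereal_sup_ubound; exists 0%N => //; exists (fun=> 0) => c _ [].
pose c := kappa * (rank (B j))%:R.
have k0 : 0 <= kappa by exact: le_trans k1.
(* With [b = 0] there is no logarithmic term, and [T] satisfies [c / T <= e]. *)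
have [|||T T1 Te] := @log_over_linear_small R c 0 e; rewrite ?mulr_ge0 //.
have [i0 Hi] := H T T1 L Lres; exists i0 => i /Hi[X' [B' [[h] [Bb' fg' rk]]]].
apply: lee_div_EFin => //.
have fB' := basis_finite (Bb' j) (fg' j jn).
apply: le_trans (retract_dimension R F h (Bb' j) fB') _.
rewrite lee_fin; apply: le_trans (rk j jn) _.
apply: (@le_trans _ _ (kappa * T^-1 * (subgroup_index (L i) * rank (B j))%:R)).
  apply: ler_wpM2l; first by rewrite mulr_ge0 // invr_ge0 (le_trans _ T1).
  by rewrite ler_nat coinv_rank_le //; exact: Lnormal.
rewrite natrM; apply: le_trans (ler_wpM2r (ltW (idx i)) Te).
by rewrite le_eqVlt; apply/orP; left; apply/eqP; rewrite /c; ring.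
Qed.

(** This follows from finite generation in degree [j + 1], but can also be obtained from a homotopy
    equivalent complex, which serves for resolutions that are finitely generated only up to degree
    [j]. *)
Definition boundaries_fin_gen (A : nzRingType) (X : chain_complex A) (j : int) : Prop :=
  exists s : seq (X j), (forall x, x \in s -> range (bd X (j + 1) j) x) /\
    range (bd X (j + 1) j) `<=` lspan [set` s].

Lemma fin_gen_boundaries (A : nzRingType) (X : chain_complex A) (j : int) :
  fin_gen (X (j + 1)) -> boundaries_fin_gen X j.
Proof.
move=> [t tX]; exists (map (bd X (j + 1) j) t); split=> [x /mapP[y _ ->]|_ [y _ <-]].
  by exists y.
have : lspan [set` t] y by rewrite tX.
apply: lspan_map; first exact: lspan_submodule.
by move=> x xt; apply: lspan_gen; rewrite /= map_f.
Qed.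

(* For a boundary [z], the homotopy gives
   [z = bd (htp z) + from (to z)], and [to z] is a boundary of [X']. *)
Lemma retract_boundaries_fin_gen (A : nzRingType) (X X' : chain_complex A) (j : int) :
  homotopy_retract X X' -> fin_gen (X j) -> fin_gen (X' (j + 1)) ->
  boundaries_fin_gen X j.
Proof.
move=> h [t tX] [t' tX'].
pose u x := bd X (j + 1) j (hr_htp h j (j + 1) x).
pose u' y := bd X (j + 1) j (hr_from h (j + 1) y).
exists (map u t ++ map u' t'); split=> [x|_ [y _ <-]].
  by rewrite mem_cat => /orP[]/mapP[y _ ->]; rewrite /u /u'; eexists.
set z := bd X (j + 1) j y; set S := lspan _.
have -> : z = u z + u' (hr_to h (j + 1) y).
  have := hr_htpP h z; rewrite bd_bd linear0 addr0 -/(u z) => ->.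
  by rewrite /u' hr_from_chain hr_to_chain subrK.
apply: lspanD.
  have : lspan [set` t] z by rewrite tX.
  apply: (lspan_map (f := bd X (j + 1) j \o hr_htp h j (j + 1))).
    exact: lspan_submodule.
  by move=> x xt; apply: lspan_gen; rewrite /= mem_cat (map_f u).
have : lspan [set` t'] (hr_to h (j + 1) y) by rewrite tX'.
apply: (lspan_map (f := bd X (j + 1) j \o hr_from h (j + 1))).
  exact: lspan_submodule.
by move=> x xt; apply: lspan_gen; rewrite /= mem_cat (map_f u') ?orbT.
Qed.

Lemma CWR_limn_esup (R : realType) (G : groupType) (n : int)
    (X : chain_complex (group_ring G)) (j : int) (tau : groupClosed G -> \bar R) :
  CWR R n X -> j <= n -> boundaries_fin_gen X j -> (forall L, (1 <= tau L)%E) ->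
  (forall L, (tau L <= tors_card R (homology (coinv L X) j))%E) ->
  forall L, residual_chain L ->
  limn_esup (fun i => lne (tau (L i)) / (subgroup_index (L i))%:R%:E)%E = 0%E.
Proof.
move=> [B [Bb fgX [kappa k1 H]]] jn [s [sbd bds]] tau1 tauX L Lres.
have [K K1 HK] := rebuilding_tors_bound R jn (Bb j) sbd bds.
apply: (limn_esup_lne_eq0 (B := B) (j := j) (K := K) (kappa := kappa)) => //.
  exact: basis_finite (Bb j) (fgX j jn).
move=> T T1; have [i0 Hi] := H T T1 L Lres; exists i0 => i /Hi /HK[] // r rle tau_le.
by exists r => //; apply: le_trans (tauX _) tau_le.
Qed.

(** For [m = n - 1] the finite generation is part of [CWR]; for [m = n] it is the additional
    assumption of the third statement. *)
Lemma CWR_Tvanish (R : realType) (G : groupType) (n m : int)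
    (X : chain_complex (group_ring G)) :
  m <= n -> CWR R n X -> fg_upto (m + 1) X -> Tvanish R m X.
Proof.
move=> mn HX fgX L Lres j jm.
apply: (@CWR_limn_esup R G n X j (fun L => tors_card R (homology (coinv L X) j))) => //.
- exact: le_trans jm mn.
- by apply/fin_gen_boundaries/fgX; rewrite lerD2r.
- by move=> ?; exact: tors_card_ge1.
Qed.

(** Restriction leaves the underlying maps and hence exactness unchanged; projectivity persists
    because the basis restricts to a basis of coset translates. *)
Lemma restr_resolution (G : groupType) (L : groupClosed G)
    (P : chain_complex (group_ring G)) (B : basis_family P) :
  based_free B -> projective_resolution P (trivial_module G) ->
  projective_resolution (restr_complex (gr_map (@subgrp_val G L)) P)
    (trivial_module (subgrp L)).
Proof.
move=> Bb [_ Pneg [eps [eps_surj eps0 Pex]]]; split=> //.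
  by move=> j; exact: basis_projective (restr_is_basis (Bb j)).
(* The augmentations of [G] and [L] agree on the group ring of [L], which makes [eps] linear over
   the smaller ring. *)
have augE a : augmentation (gr_map (@subgrp_val G L) a) = augmentation a.
  elim/group_ring_ind: a => [|a b IHa IHb|g].
  - by rewrite !rmorph0.
  - by rewrite rmorphB [LHS](rmorphB (@augmentation _)) [RHS](rmorphB (@augmentation _));
      congr (_ - _).
  by apply: etrans (congr1 _ (gr_map_gr_of g)) _; rewrite [LHS]gr_liftU [RHS]gr_liftU.
pose epsL : restr_complex (gr_map (@subgrp_val G L)) P 0 ->
  trivial_module (subgrp L) := eps.
have eps_lin : linear epsL.
  move=> a x y; apply: etrans (linearP eps _ x y) _.
  by rewrite /GRing.scale /= /restr_scale /= augE.
pose epsLL := GRing.isLinear.Build _ _ _ *:%R epsL eps_lin.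
by exists (HB.pack epsL epsLL : {linear _ -> trivial_module (subgrp L)}).
Qed.

Lemma CWR_Tvanish_group (R : realType) (G : groupType) (n : int) :
  CWR_group R G n -> type_FP G (n + 1) -> Tvanish_group R G n.
Proof.
move=> [Gres [P [resP HP]]] [P' [resP' fgP']]; split=> // L Lres j jn.
have [B [Bb fgP _]] := HP.
have [h] := projective_resolution_retract resP resP'.
apply: (@CWR_limn_esup R G n P j
  (fun L => tors_card R (group_homology (subgrp L) j))) => //.
(* [P] supplies finite generation in degree [j], and [P'] supplies it in degree [j + 1]. *)
- apply: (retract_boundaries_fin_gen h (fgP j jn)).
  by apply: fgP'; rewrite lerD2r.
- by move=> ?; exact: tors_card_ge1.
move=> K.
(* [group_homology] comes from the standard free resolution of the subgroup; comparison with the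
   restriction of [P] injects its torsion into that of [coinv K P]. *)
have [h'] := projective_resolution_retract (free_resolutionP (trivial_module (subgrp K)))
  (restr_resolution K Bb resP).
exact: retract_tors_card (base_change_retract (@augmentation (subgrp K)) h').
Qed.

Theorem lemma5p13 (R : realType) (G : groupType) (n : int)
    (X : chain_complex (group_ring G)) (hG : residually_finite G) :
  [/\ (CD R n X -> forall F : fieldType, Hvanish R n F X),
      (CWR R n X -> Tvanish R (n - 1) X),
      (CWR R n X -> fg_upto (n + 1) X -> Tvanish R n X) &
      (CWR_group R G n -> type_FP G (n + 1) -> Tvanish_group R G n)].
Proof.
split.
- by move=> HX F; exact: CD_Hvanish.
- move=> HX; apply: (CWR_Tvanish (n := n)) => //; first by rewrite gerBl.
  by rewrite subrK; have [B []] := HX.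
- exact: CWR_Tvanish.
- exact: CWR_Tvanish_group.
Qed.
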